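(* Let $T>0$ and $(f,u_0,u)\in\mathcal{I}_T$. Then, for each $0<t\le T$, $(f,u_0,u|_{\bar D_t})\in\mathcal{I}_t$ and $$\|u_x(\cdot,t)\|_B\le\mathcal{F}_t(f,u_0,u|_{\bar D_t}).$$
   Context: For $\lambda>0$ let $D_\lambda=\mathbb{R}\times(0,\lambda]$, $\bar D_\lambda=\mathbb{R}\times[0,\lambda]$ and $\partial D=\mathbb{R}\times\{0\}$. $B_A^\lambda$ is the space of bounded continuous functions $u:\bar D_\lambda\to\mathbb{R}$. $B_B$ is the space of bounded continuous functions $\mathbb{R}\to\mathbb{R}$, with sup norm $\|v\|_B=\sup_{x\in\mathbb{R}}|v(x)|$. $\mathrm{BPC}^1(\mathbb{R})$ is the set of bounded, continuous functions $v:\mathbb{R}\to\mathbb{R}$ with piecewise continuous bounded derivative $v'$; $\|v'\|_B$ denotes the supremum of $|v'|$ (where $v'$ is defined). $\mathcal{A}_\lambda=\{(f,v,u): f\in C(\mathbb{R}),\ v\in \mathrm{BPC}^1(\mathbb{R}),\ u\in B_A^\lambda\}$, and $\mathcal{F}_\lambda:\mathcal{A}_\lambda\to[0,\infty)$ is $$\mathcal{F}_\lambda(f,v,u)=\|v'\|_B+\frac{1}{\sqrt{\pi}}\int_0^\lambda\frac{\|f(u(\cdot,\tau))\|_B}{(\lambda-\tau)^{1/2}}\,d\tau .$$ For $T>0$, $f\in C(\mathbb{R})$, $u_0\in \mathrm{BPC}^1(\mathbb{R})$, a solution to [IVP] with $f$ and $u_0$ is a function $u:\bar D_T\to\mathbb{R}$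 with $u\in C(\bar D_T)\cap C^{2,1}(D_T)\cap L^\infty(\bar D_T)$ ($C^{2,1}$: $u_t,u_x,u_{xx}$ exist and are continuous) such that $u_t-u_{xx}=f(u)$ on $D_T$ and $u=u_0$ on $\partial D$. $\mathcal{I}_T$ is the set of $(f,u_0,u)\in\mathcal{A}_T$ such that $u:\bar D_T\to\mathbb{R}$ is a solution to [IVP] with $f$ and $u_0$. *)

(* Defs.v *)
From HB Require Import structures.
From mathcomp Require Import all_boot all_order all_algebra.
From mathcomp Require Import all_classical all_reals all_analysis.
From mathcomp Require Import measurable_realfun.

Set Implicit Arguments.
Unset Strict Implicit.
Unset Printing Implicit Defensive.

Import Order.TTheory GRing.Theory Num.Theory.
Import numFieldNormedType.Exports.

Local Open Scope classical_set_scope.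
Local Open Scope ring_scope.

(* A function on a strip is a total function of the pair (x, t); every notion
   below only looks at its values on the strip. *)

Definition strip (R : realType) (lam : R) : set (R * R) :=
  [set p | 0 < p.2 <= lam].

Definition cstrip (R : realType) (lam : R) : set (R * R) :=
  [set p | 0 <= p.2 <= lam].

(* The sup norms take values in \bar R, because the real-valued [sup] of an
   unbounded set is 0. *)

Definition normB (R : realType) (v : R -> R) : \bar R :=
  ereal_sup [set `|v x|%:E | x in [set: R]].

Definition normB_deriv (R : realType) (v : R -> R) : \bar R :=
  ereal_sup [set `|derive1 v x|%:E | x in [set x | derivable v x 1]].

Definition BA (R : realType) (lam : R) (u : R * R -> R) : Prop :=
  {within cstrip lam, continuous u} /\ [bounded u p | p in cstrip lam].

(* [S] is the set of exceptional points: finitely many in each bounded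
   interval, with finite one-sided limits of the derivative there. *)
Definition piecewise_continuous_deriv (R : realType) (v : R -> R) : Prop :=
  exists S : set R,
    [/\ forall a b : R, finite_set (S `&` `[a, b]),
        forall x, ~ S x -> derivable v x 1 /\ {for x, continuous (derive1 v)} &
        forall x, S x ->
          cvg (derive1 v y @[y --> x^'-]) /\ cvg (derive1 v y @[y --> x^'+])].

Definition BPC1 (R : realType) (v : R -> R) : Prop :=
  [/\ continuous v, bounded_fun v, piecewise_continuous_deriv v &
      [bounded derive1 v x | x in [set x | derivable v x 1]]].

Definition Aset (R : realType) (lam : R) (f v : R -> R) (u : R * R -> R) :
    Prop :=
  [/\ continuous f, BPC1 v & BA lam u].

Definition Ffun (R : realType) (lam : R) (f v : R -> R) (u : R * R -> R) :
    \bar R :=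
  (normB_deriv v +
   ((Num.sqrt pi)^-1)%:E *
   \int[lebesgue_measure]_(tau in `[0%R, lam[)
     (normB (fun x => f (u (x, tau))) * ((Num.sqrt (lam - tau))^-1)%:E))%E.

Definition dx (R : realType) (u : R * R -> R) (p : R * R) : R :=
  derive1 (fun y => u (y, p.2)) p.1.

Definition derivable_x (R : realType) (u : R * R -> R) (p : R * R) : Prop :=
  derivable (fun y => u (y, p.2)) p.1 1.

(* The time derivative is taken relative to (0, lam], so it is the ordinary
   derivative for t < lam and the left derivative for t = lam. *)

Definition dt_quotient (R : realType) (lam : R) (u : R * R -> R) (p : R * R) :=
  (s - p.2)^-1 * (u (p.1, s) - u p) @[s --> within `]0, lam] (p.2)^'].

Definition derivable_t (R : realType) (lam : R) (u : R * R -> R) (p : R * R) :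
    Prop :=
  cvg (dt_quotient lam u p).

Definition dt (R : realType) (lam : R) (u : R * R -> R) (p : R * R) : R :=
  lim (dt_quotient lam u p).

Definition C21 (R : realType) (lam : R) (u : R * R -> R) : Prop :=
  [/\ forall p, strip lam p ->
        [/\ derivable_t lam u p, derivable_x u p & derivable_x (dx u) p],
      {within strip lam, continuous (dt lam u)},
      {within strip lam, continuous (dx u)} &
      {within strip lam, continuous (dx (dx u))}].

Definition IVP_solution (R : realType) (T : R) (f u0 : R -> R)
    (u : R * R -> R) : Prop :=
  [/\ {within cstrip T, continuous u}, C21 T u,
      [bounded u p | p in cstrip T],
      forall p, strip T p -> dt T u p - dx (dx u) p = f (u p) &
      forall x, u (x, 0) = u0 x].

Definition Iset (R : realType) (T : R) (f u0 : R -> R) (u : R * R -> R) :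
    Prop :=
  Aset T f u0 u /\ IVP_solution T f u0 u.

(* The functional is real-valued on its domain. *)
Lemma Ffun_ge0_lty (R : realType) (lam : R) (f v : R -> R) (u : R * R -> R) :
  0 < lam -> Aset lam f v u -> (0 <= Ffun lam f v u < +oo)%E.
Proof.
move=> lam0 [cf [_ _ [S [Sfin Sd _]] [M1 [_ bv']]] [_ [M2 [_ bu]]]].
have normB_ge0 g : (0 <= normB (g : R -> R))%E.
  apply: (@le_trans _ _ `|g 0|%:E); first by rewrite lee_fin.
  by apply: ereal_sup_ubound; exists 0.
have nv0 : (0 <= normB_deriv v)%E.
  have [x Sx] : exists x, ~ S x.
    apply: contrapT => /forallNP allS.
    have := Sfin 0 1; rewrite (_ : S `&` _ = `[0, 1]%classic); last first.
      by apply/seteqP; split => [y []//|y y01]; split => //; apply: contrapT.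
    move=> /finite_set_countable/countable_lebesgue_measure0.
    by move/eqP; rewrite lebesgue_measure_itv/= lte_fin ltr01 oppr0 adde0 onee_eq0.
  have [dv _] := Sd _ Sx.
  apply: (@le_trans _ _ `|derive1 v x|%:E); first by rewrite lee_fin.
  by apply: ereal_sup_ubound; exists x.
have nvoo : (normB_deriv v < +oo)%E.
  apply: (@le_lt_trans _ _ (M1 + 1)%:E); last exact: ltry.
  apply: ge_ereal_sup => _ [x /= dv <-]; rewrite lee_fin.
  by apply: bv' => //; rewrite ltrDl.
have [M M0 fuM] : exists2 M, 0 <= M & forall tau, 0 <= tau <= lam ->
    (normB (fun x => f (u (x, tau))) <= M%:E)%E.
  have : compact (f @` `[- (M2 + 1), M2 + 1]).
    apply: continuous_compact; last exact: segment_compact.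
    exact: continuous_subspaceT.
  move=> /compact_bounded[M3 [_ bf]].
  exists (`|M3| + 1) => [|tau tau_lam]; first by rewrite addr_ge0.
  apply: ge_ereal_sup => _ [x _ <-]; rewrite lee_fin.
  apply: bf; first by rewrite ltr_pwDr// ler_norm.
  exists (u (x, tau)) => //=; rewrite in_itv/= -ler_norml.
  by apply: bu => //; rewrite ltrDl.
rewrite /Ffun; set I := integral _ _ _.
have I0 : (0 <= I)%E.
  apply: integral_ge0 => tau _; apply: mule_ge0; first exact: normB_ge0.
  by rewrite lee_fin invr_ge0 sqrtr_ge0.
suff Ioo : (I < +oo)%E.
  have c0 : (0 <= ((Num.sqrt pi)^-1 : R)%:E)%E.
    by rewrite lee_fin invr_ge0 sqrtr_ge0.
  apply/andP; split.
    by rewrite adde_ge0// mule_ge0.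
  by apply: lte_add_pinfty => //; apply: lte_mul_pinfty.
pose g tau : R := M * (Num.sqrt (lam - tau))^-1.
have sub_cont : continuous (fun tau : R => lam - tau).
  by move=> x; apply: cvgB; [exact: cvg_cst|exact: cvg_id].
have gc (tau : R) : tau < lam -> {for tau, continuous g}.
  move=> tl; apply: cvgM; first exact: cvg_cst.
  apply: cvgV; first by rewrite gt_eqF// sqrtr_gt0 subr_gt0.
  by apply: (@continuous_comp _ _ _ (fun tau : R => lam - tau) Num.sqrt);
    [exact: sub_cont|exact: sqrt_continuous].
pose G tau : R := - (2 * M) * Num.sqrt (lam - tau).
have Gc : continuous G.
  move=> x; apply: cvgM; first exact: cvg_cst.
  by apply: (@continuous_comp _ _ _ (fun tau : R => lam - tau) Num.sqrt);
    [exact: sub_cont|exact: sqrt_continuous].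
have Gd (x : R) : x < lam -> is_derive x 1 G (g x).
  move=> xl; have lx : 0 < lam - x by rewrite subr_gt0.
  have ds := is_derive1_sqrt lx.
  have dl : is_derive x 1 (fun tau : R => lam - tau) (-1).
    by apply: is_derive_eq; rewrite add0r mul1r.
  have dc := @is_derive1_comp _ Num.sqrt (fun tau : R => lam - tau) _ _ _ ds dl.
  have -> : G = (- (2 * M)) \*: (Num.sqrt \o (fun tau : R => lam - tau)).
    by apply/funext.
  apply: is_derive_eq; rewrite /g /GRing.scale/= mulrN1 mulrNN invfM.
  by rewrite mulrA; congr (_ * _); rewrite mulrAC divff ?mul1r// pnatr_eq0.
pose b n : R := lam - lam / n.+2%:R.
have b_lt n : b n < lam by rewrite ltrBlDr ltrDl divr_gt0.
have b_gt0 n : 0 < b n.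
  by rewrite subr_gt0 ltr_pdivrMr// ltr_pMr// ltr1n.
pose F n := `[0, b n]%classic.
have FU : \bigcup_n F n = `[0, lam[%classic.
  apply/seteqP; split => [x [n _]|x]; rewrite /F /= !in_itv/=.
    by move=> /andP[-> /le_lt_trans]; apply.
  move=> /andP[x0 xl]; have lx : 0 < lam - x by rewrite subr_gt0.
  exists (Num.truncn (lam / (lam - x))) => //=; rewrite in_itv/= x0/= /b.
  rewrite lerBrDr addrC -lerBrDr ler_pdivrMr// mulrC -ler_pdivrMr//.
  apply: ltW; apply: (lt_trans (truncnS_gt _)).
  by rewrite ltr_nat.
have gF n : {within F n, continuous g}.
  apply: continuous_in_subspaceT => x; rewrite inE /F/= in_itv/= => /andP[_ xb].
  by apply: gc; exact: le_lt_trans xb (b_lt n).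
have mg n : measurable_fun (F n) (fun x : R => (g x)%:E).
  apply/measurable_EFinP; apply: subspace_continuous_measurable_fun (gF n).
  exact: measurable_itv.
have g0 x : 0 <= g x by rewrite mulr_ge0// invr_ge0 sqrtr_ge0.
have ndF : nondecreasing_seq F.
  move=> m n mn; apply/subsetPset => x; rewrite /F/= !in_itv/= => /andP[-> xb].
  apply: (le_trans xb); rewrite /b lerB// ler_wpM2l ?(ltW lam0)//.
  by rewrite lef_pV2 ?posrE// ler_nat.
have Ign n : (\int[lebesgue_measure]_(x in F n) (g x)%:E
               <= (2 * M * Num.sqrt lam)%:E)%E.
  rewrite (@continuous_FTC2 _ g G)//.
  - rewrite -EFinB lee_fin /G subr0 mulNr mulNr opprK.
    by rewrite gerDr oppr_le0 !mulr_ge0// sqrtr_ge0.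
  - exact: gF.
  - split.
    + move=> x; rewrite in_itv/= => /andP[_ xb].
      by have [] := Gd _ (lt_trans xb (b_lt n)).
    + exact/cvg_at_right_filter/Gc.
    + exact/cvg_at_left_filter/Gc.
  - move=> x; rewrite in_itv/= => /andP[_ xb].
    by have [_ <-] := Gd _ (lt_trans xb (b_lt n)); rewrite derive1E.
have Ig : (\int[lebesgue_measure]_(x in `[0%R, lam[) (g x)%:E
            <= (2 * M * Num.sqrt lam)%:E)%E.
  rewrite -FU.
  have cvgF : (\int[lebesgue_measure]_(x in F i) (g x)%:E @[i --> \oo] -->
      \int[lebesgue_measure]_(x in \bigcup_i F i) (g x)%:E)%E.
    apply: ge0_nondecreasing_set_cvg_integral => //.
      by move=> n; exact: measurable_itv.
    by move=> n x _; rewrite lee_fin.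
  have /cvg_lim <- // := cvgF.
  apply: lime_le; last by near=> n; exact: Ign.
  by apply/cvg_ex; eexists; exact: cvgF.
apply: le_lt_trans (ltry (2 * M * Num.sqrt lam)); apply: le_trans Ig.
have h0 tau : (0 <= normB (fun x => f (u (x, tau))) *
    ((Num.sqrt (lam - tau))^-1)%:E)%E.
  by rewrite mule_ge0// lee_fin invr_ge0 sqrtr_ge0.
rewrite /I !ge0_integralE//; last by move=> x _; rewrite lee_fin.
(* [normB (f (u (., tau)))] need not be continuous in [tau]. *)
apply: ereal_sup_le => _ /= [h hI <-]; exists h => // x.
apply: (le_trans (hI x)); rewrite /patch; case: ifPn => //.
rewrite inE/= in_itv/= => /andP[x0 xl].
rewrite /g EFinM lee_wpmul2r// ?lee_fin ?invr_ge0 ?sqrtr_ge0//.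
by apply: fuM; rewrite x0 ltW.
Unshelve. all: by end_near. Qed.

(* Main.v *)
Require Import Defs.
From HB Require Import structures.
From mathcomp Require Import all_boot all_order all_algebra.
From mathcomp Require Import all_classical all_reals all_analysis.
From mathcomp Require Import measurable_realfun ring lra.
Set Implicit Arguments.
Unset Strict Implicit.
Unset Printing Implicit Defensive.
Import Order.TTheory GRing.Theory Num.Theory.
Import numFieldNormedType.Exports.
Local Open Scope classical_set_scope.
Local Open Scope ring_scope.

(* For fixed x, the odd part v(s, tau) = +-(u(x + s, tau) - u(x - s, tau))
   solves v_t - v_ss = +-(f(u(x + s, tau)) - f(u(x - s, tau))) on s > 0, with
   v(0, .) = 0 and v(s, 0) <= 2 s |u0'|.  Let E(s, tau) be the solution of
   E_t - E_ss = 1 on the half line with zero data, extended by 0 to tau <= 0;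
   then E_t = erf(s / (2 sqrt tau)) for tau > 0, so that
   0 <= E(s, b) - E(s, a) <= (2 / sqrt pi) s (sqrt b - sqrt a).  Cut [0, t] at
   times d_k, and let m_k + eps bound |f(u)| on the k-th slab above a large
   interval, with m_k <= |f(u(., tau))|_B there.  By the minimum principle on
   [0, l] x [0, t], v lies below
     2 s |u0'| + sum_k 2 (m_k + eps) (E(s, tau - d_k) - E(s, tau - d_(k+1)))
       + (2 M / l^2) (s^2 + 3 tau),
   where M bounds |u|.  At tau = t the sum is at most 2 s / sqrt pi times the
   integral in F_t, up to O(eps).  Let eps -> 0 and l -> oo, divide by 2 s and
   let s -> 0. *)

(** * Differentiation rules for explicit functions of one real variable *)

Section pointwise_derive.
Context {R : realType}.
Implicit Types (f g : R -> R) (x a b c : R).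

(** With explicit [fun y => ...] in place of the pointwise operations, the rules compose as proof
    terms and unify with concrete formulas. *)
Lemma is_derive1D f g x a b : is_derive x 1 f a -> is_derive x 1 g b ->
  is_derive x 1 (fun y => f y + g y) (a + b).
Proof. exact: is_deriveD. Qed.

Lemma is_derive1B f g x a b : is_derive x 1 f a -> is_derive x 1 g b ->
  is_derive x 1 (fun y => f y - g y) (a - b).
Proof. exact: is_deriveB. Qed.

Lemma is_derive1Ml f x a c : is_derive x 1 f a ->
  is_derive x 1 (fun y => c * f y) (c * a).
Proof. exact: is_deriveZ. Qed.

Lemma is_derive1M f g x a b : is_derive x 1 f a -> is_derive x 1 g b ->
  is_derive x 1 (fun y => f y * g y) (f x * b + g x * a).
Proof. exact: is_deriveM. Qed.

Lemma is_derive1_cst x c : is_derive x 1 (fun _ => c) 0.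
Proof. exact: is_derive_cst. Qed.

Lemma is_derive1_sqr x : is_derive x 1 (fun y : R => y ^+ 2) (2 * x).
Proof.
by apply: is_derive_eq; rewrite /GRing.scale/=; ring.
Qed.

Lemma is_derive1_continuous f x a : is_derive x 1 f a -> {for x, continuous f}.
Proof.
by move=> [df _]; apply: differentiable_continuous; apply/derivable1_diffP.
Qed.

End pointwise_derive.

(** * Gaussian primitive, error function and self-similar heat profile *)

Section heat_profile.
Context {R : realType}.
Implicit Types x z w : R.
Let mu := @lebesgue_measure R.

(** The signed integral of exp(-t^2) from 0 to x. Starting both integrals at -oo lets one use of the
    fundamental theorem of calculus cover every real x. *)
Definition gauss_prim x : R :=
  \int[mu]_(t in `]-oo, x]) gauss_fun t -
  \int[mu]_(t in `]-oo, 0%R]) gauss_fun t.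

Lemma is_derive_gauss_prim x : is_derive x 1 gauss_prim (gauss_fun x).
Proof.
pose F y := \int[mu]_(t in [set` Interval -oo%O (BRight y)]) gauss_fun t.
have [dF F'] : derivable F x 1 /\ derive1 F x = gauss_fun x.
  apply: (@continuous_FTC1 R gauss_fun -oo%O x (x + 1)).
  - by rewrite ltrDl.
  - by apply: integrableS integrableT_gauss.
  - by rewrite ltNyr.
  - exact: continuous_gauss_fun.
have dF' : is_derive x 1 F (gauss_fun x).
  by apply: DeriveDef; [exact: dF|rewrite -derive1E].
rewrite (_ : gauss_prim = (F - cst (F 0))).
  by apply: is_derive_eq; rewrite subr0.
by apply/funext.
Qed.

Lemma gauss_prim0 : gauss_prim 0 = 0.
Proof. by rewrite /gauss_prim subrr. Qed.

Lemma continuous_gauss_prim : continuous gauss_prim.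
Proof.
by move=> x; exact: is_derive1_continuous (is_derive_gauss_prim x).
Qed.

Lemma gauss_prim_le x w : x <= w -> gauss_prim x <= gauss_prim w.
Proof.
move=> xw; have [c _] := @MVT_segment _ gauss_prim gauss_fun x w xw
  (fun c _ => is_derive_gauss_prim c)
  (continuous_subspaceT continuous_gauss_prim).
by rewrite -subr_ge0 => ->; rewrite mulr_ge0 ?gauss_fun_ge0// subr_ge0.
Qed.

Lemma gauss_prim_le_id z : 0 <= z -> gauss_prim z <= z.
Proof.
move=> z0; have [c _] := @MVT_segment _ gauss_prim gauss_fun 0 z z0
  (fun c _ => is_derive_gauss_prim c)
  (continuous_subspaceT continuous_gauss_prim).
rewrite gauss_prim0 !subr0 => ->.
by rewrite ler_piMl// gauss_fun_le1.
Qed.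

Lemma gauss_prim_ge0 z : 0 <= z -> 0 <= gauss_prim z.
Proof. by move=> z0; rewrite -gauss_prim0 gauss_prim_le. Qed.

Lemma gauss_primE z : 0 < z ->
  gauss_prim z = gauss_integral_proof.integral0_gauss z.
Proof.
move=> z0; rewrite /gauss_integral_proof.integral0_gauss /Rintegral.
rewrite (@continuous_FTC2 _ gauss_fun gauss_prim 0 z)//.
- by rewrite gauss_prim0 sube0.
- exact: continuous_subspaceT continuous_gauss_fun.
- split; first by move=> x _; have [] := is_derive_gauss_prim x.
    exact/cvg_at_right_filter/continuous_gauss_prim.
  exact/cvg_at_left_filter/continuous_gauss_prim.
- by move=> x _; rewrite derive1E; have [] := is_derive_gauss_prim x.
Qed.

(** The square of the integral over [0, x] is known to tend to pi / 4; the integral is nonnegative,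
    so the square root can be taken. *)
Lemma cvg_gauss_prim : gauss_prim x @[x --> +oo] --> Num.sqrt pi / 2.
Proof.
have : Num.sqrt (@gauss_integral_proof.integral0_gauss R x ^+ 2) @[x --> +oo]
    --> Num.sqrt (pi / 4).
  apply: continuous_cvg; first exact: sqrt_continuous.
  exact: gauss_integral_proof.cvg_integral0_gauss_sqr.
rewrite sqrtrM ?pi_ge0// sqrtrV// (_ : 4 = 2 ^+ 2 :> R); last ring.
rewrite sqrtr_sqr ger0_norm//; apply: cvg_trans; apply: near_eq_cvg.
near=> x.
have x0 : 0 < x by near: x; exact: nbhs_pinfty_gt.
by rewrite gauss_primE// sqrtr_sqr ger0_norm//
  gauss_integral_proof.integral0_gauss_ge0.
Unshelve. all: by end_near. Qed.

Lemma is_derive_gauss_fun x : is_derive x 1 gauss_fun (- (2 * x) * gauss_fun x).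
Proof.
have d2 : is_derive x 1 (fun y : R => - y ^+ 2) (- (2 * x)).
  by apply: is_derive_eq; rewrite /GRing.scale/=; ring.
have := @is_derive1_comp _ expR (fun y : R => - y ^+ 2) _ _ _
  (is_derive_expR _) d2.
by rewrite mulrC.
Qed.

(** The function gauss_prim x + gauss_fun x / (2 z) has derivative (1 - x / z) exp(-x^2), so it
    decreases past z; compare its value at z with the limit at +oo. *)
Lemma gauss_prim_tail z : 0 < z ->
  z * (Num.sqrt pi / 2 - gauss_prim z) <= gauss_fun z / 2.
Proof.
move=> z0.
have bnd w : z <= w -> gauss_prim w <= gauss_prim z + gauss_fun z / (2 * z).
  move=> zw.
  pose D x := gauss_prim x + (2 * z)^-1 * gauss_fun x.
  have dD x : is_derive x 1 D ((1 - x / z) * gauss_fun x).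
    have d1 := is_derive_gauss_prim x; have d2 := is_derive_gauss_fun x.
    apply: (is_derive_eq (is_deriveD d1 (is_deriveZ (2 * z)^-1 d2))).
    by rewrite /GRing.scale/=; field; rewrite gt_eqF.
  have cD : {within `[z, w], continuous D}.
    by apply: continuous_subspaceT => x; exact: is_derive1_continuous (dD x).
  have [c] := MVT_segment zw (fun c _ => dD c) cD.
  rewrite in_itv/= => /andP[zc cw] DE.
  have : D w <= D z.
    rewrite -subr_le0 DE; apply: mulr_le0_ge0; last by rewrite subr_ge0.
    apply: mulr_le0_ge0; last exact: gauss_fun_ge0.
    by rewrite subr_le0 ler_pdivlMr// mul1r.
  have : 0 <= (2 * z)^-1 * gauss_fun w.
    by rewrite mulr_ge0 ?gauss_fun_ge0// invr_ge0 mulr_ge0// ltW.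
  rewrite /D; set a := gauss_prim w; set b := gauss_prim z.
  by rewrite [gauss_fun z / _]mulrC; lra.
have : Num.sqrt pi / 2 <= gauss_prim z + gauss_fun z / (2 * z).
  have /cvg_lim <- // := cvg_gauss_prim.
  apply: limr_le; first by apply/cvg_ex; eexists; exact: cvg_gauss_prim.
  near=> w; apply: bnd; apply: ltW; near: w.
  by apply: nbhs_pinfty_gt; exact: num_real.
rewrite -lerBlDl -(ler_pM2l z0) => /le_trans; apply.
by rewrite le_eqVlt; apply/orP; left; apply/eqP; field; rewrite gt_eqF.
Unshelve. all: by end_near. Qed.

Lemma sqrt_pi_gt0 : 0 < Num.sqrt pi :> R.
Proof. by rewrite sqrtr_gt0 pi_gt0. Qed.

Definition erf x : R := 2 / Num.sqrt pi * gauss_prim x.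

Lemma erf0 : erf 0 = 0.
Proof. by rewrite /erf gauss_prim0 mulr0. Qed.

Lemma erf_ge0 z : 0 <= z -> 0 <= erf z.
Proof.
by move=> z0; rewrite mulr_ge0 ?gauss_prim_ge0.
Qed.

Lemma erf_le z : 0 <= z -> erf z <= 2 / Num.sqrt pi * z.
Proof.
by move=> z0; rewrite ler_wpM2l ?gauss_prim_le_id.
Qed.

Lemma erf_le1 z : erf z <= 1.
Proof.
have s0 := sqrt_pi_gt0.
suff h : gauss_prim z <= Num.sqrt pi / 2.
  by rewrite /erf mulrAC ler_pdivrMr// mul1r -ler_pdivlMl// mulrC.
have /cvg_lim <- // := cvg_gauss_prim.
apply: limr_ge; first by apply/cvg_ex; eexists; exact: cvg_gauss_prim.
near=> w; apply: gauss_prim_le; apply: ltW; near: w.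
by apply: nbhs_pinfty_gt; exact: num_real.
Unshelve. all: by end_near. Qed.

Lemma erf_tail z : 0 <= z -> z * (1 - erf z) <= gauss_fun z / Num.sqrt pi.
Proof.
have s0 := sqrt_pi_gt0.
rewrite le_eqVlt => /predU1P[<-|z0].
  by rewrite mul0r divr_ge0// ?gauss_fun_ge0// ltW.
have := gauss_prim_tail z0; rewrite -(ler_pM2l (_ : 0 < 2 / Num.sqrt pi)).
  move=> h; apply: le_trans (le_trans h _); rewrite le_eqVlt;
    by apply/orP; left; apply/eqP; rewrite /erf; field; rewrite gt_eqF.
by rewrite divr_gt0.
Qed.

(* t * heat_profile (s / (2 sqrt t)) is the solution on the half line of
   E_t - E_ss = 1 with zero initial and boundary values. *)
Definition heat_profile z : R :=
  (1 + 2 * z ^+ 2) * erf z + 2 / Num.sqrt pi * (z * gauss_fun z) - 2 * z ^+ 2.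

(** This is 4 ierfc(z), with ierfc the first iterated integral of erfc = 1 - erf; correspondingly
    [heat_profile] is 1 minus 4 times the second one. *)
Definition heat_profile' z : R :=
  4 / Num.sqrt pi * gauss_fun z - 4 * (z * (1 - erf z)).

Lemma is_derive_erf z : is_derive z 1 erf (2 / Num.sqrt pi * gauss_fun z).
Proof. by have := is_deriveZ (2 / Num.sqrt pi) (is_derive_gauss_prim z). Qed.

Lemma is_derive_heat_profile z : is_derive z 1 heat_profile (heat_profile' z).
Proof.
have d1 := is_derive_erf z; have d2 := is_derive_gauss_fun z.
apply: (is_derive_eq (is_derive1B
  (is_derive1D
    (is_derive1M
      (is_derive1D (is_derive1_cst z 1) (is_derive1Ml 2 (is_derive1_sqr z)))
      d1)
    (is_derive1Ml (2 / Num.sqrt pi) (is_derive1M (is_derive_id z 1) d2)))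
  (is_derive1Ml 2 (is_derive1_sqr z)))).
by rewrite /heat_profile'; field; rewrite gt_eqF// sqrt_pi_gt0.
Qed.

Lemma is_derive_heat_profile' z :
  is_derive z 1 heat_profile' (4 * (erf z - 1)).
Proof.
have d1 := is_derive_erf z; have d2 := is_derive_gauss_fun z.
apply: (is_derive_eq (is_derive1B (is_derive1Ml (4 / Num.sqrt pi) d2)
  (is_derive1Ml 4 (is_derive1M (is_derive_id z 1)
    (is_derive1B (is_derive1_cst z 1) d1))))).
by field; rewrite gt_eqF// sqrt_pi_gt0.
Qed.

Lemma continuous_heat_profile : continuous heat_profile.
Proof.
by move=> x; exact: is_derive1_continuous (is_derive_heat_profile x).
Qed.

(** The left side is the t-derivative of t * heat_profile (s / (2 sqrt t)), since z = s / (2 sqrt t)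
    has t-derivative - z / (2 t). *)
Lemma heat_profile_ode z : heat_profile z - z / 2 * heat_profile' z = erf z.
Proof.
by rewrite /heat_profile /heat_profile'; field; rewrite gt_eqF// sqrt_pi_gt0.
Qed.

Lemma heat_profile0 : heat_profile 0 = 0.
Proof. by rewrite /heat_profile erf0 !mul0r expr0n/= !mulr0 subr0 addr0. Qed.

(** By [erf_tail] the derivative is nonnegative on z >= 0, so the profile increases from its value 0
    at 0. *)
Lemma heat_profile_ge0 z : 0 <= z -> 0 <= heat_profile z.
Proof.
move=> z0; have [c] := @MVT_segment _ heat_profile heat_profile' 0 z z0
  (fun c _ => is_derive_heat_profile c)
  (continuous_subspaceT continuous_heat_profile).
rewrite in_itv/= => /andP[c0 _]; rewrite heat_profile0 !subr0 => ->.
rewrite mulr_ge0//; have := erf_tail c0; rewrite /heat_profile' subr_ge0.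
by rewrite mulrAC -mulrA => h; rewrite ler_wpM2l.
Qed.

(** Written as erf z + 2 z^2 (erf z - 1) plus the Gaussian term, the profile is at most 1 + 0 + 2. A
    crude bound suffices: it serves for continuity at t = 0. *)
Lemma heat_profile_le z : 0 <= z -> heat_profile z <= 3.
Proof.
move=> z0; rewrite /heat_profile.
have s1 : 1 <= Num.sqrt pi :> R.
  by rewrite -[leLHS]sqrtr1 ler_wsqrtr// (le_trans _ (@pi_ge2 R))// ler1n.
have h1 : z * gauss_fun z <= 1.
  rewrite /gauss_fun expRN ler_pdivrMr ?expR_gt0// mul1r.
  apply: le_trans (expR_ge1Dx _); nra.
have h2 : 2 / Num.sqrt pi * (z * gauss_fun z) <= 2.
  rewrite -[leRHS]mulr1 ler_pM// ?mulr_ge0 ?gauss_fun_ge0// //.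
  by rewrite ler_pdivrMr ?sqrt_pi_gt0// ler_peMr.
have := erf_le1 z; set E := erf z; set X := _ * (_ * _) in h2 *.
by have := sqr_ge0 z; set Y := z ^+ 2; nra.
Qed.

End heat_profile.

(** * The half-line solution with unit source, extended by zero *)

Section heat_source.
Context {R : realType}.
Implicit Types s t : R.

(* For [t <= 0] the convention [Num.sqrt t = 0] makes this 0. *)
Definition heat_source s t : R := t * heat_profile (s / (2 * Num.sqrt t)).

Lemma heat_source_le0 s t : t <= 0 -> heat_source s t = 0.
Proof.
by move=> t0; rewrite /heat_source ler0_sqrtr// mulr0 invr0 mulr0
  heat_profile0 mulr0.
Qed.

Lemma heat_source_bound s t : 0 <= s -> `|heat_source s t| <= 3 * `|t|.
Proof.
move=> s0; have [t0|t0] := leP t 0.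
  by rewrite heat_source_le0// normr0 mulr_ge0.
have z0 : 0 <= s / (2 * Num.sqrt t) by rewrite divr_ge0// mulr_ge0// sqrtr_ge0.
rewrite normrM mulrC ler_wpM2r// ger0_norm ?heat_profile_ge0//.
exact: heat_profile_le.
Qed.

Definition heat_source_s t s : R :=
  Num.sqrt t / 2 * heat_profile' (s / (2 * Num.sqrt t)).

Lemma is_derive_heat_source_s s t : 0 < t ->
  is_derive s 1 (heat_source^~ t) (heat_source_s t s).
Proof.
move=> t0; have st0 : Num.sqrt t != 0 by rewrite gt_eqF// sqrtr_gt0.
have d1 :
    is_derive s 1 (fun y => (2 * Num.sqrt t)^-1 * y) (2 * Num.sqrt t)^-1.
  by apply: (is_derive_eq (is_derive1Ml _ (is_derive_id s 1))); rewrite mulr1.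
have d2 := is_derive1Ml t
  (is_derive1_comp (is_derive_heat_profile ((2 * Num.sqrt t)^-1 * s)) d1).
rewrite (_ : heat_source^~ t =
  fun y => t * (heat_profile \o (fun y => (2 * Num.sqrt t)^-1 * y)) y).
  apply: (is_derive_eq d2); rewrite /heat_source_s [s / _]mulrC.
  by rewrite -{1}(sqr_sqrtr (ltW t0)); field.
by apply/funext => y; rewrite /heat_source /= [y / _]mulrC.
Qed.

Lemma is_derive_heat_source_ss s t : 0 < t ->
  is_derive s 1 (heat_source_s t) (erf (s / (2 * Num.sqrt t)) - 1).
Proof.
move=> t0; have st0 : Num.sqrt t != 0 by rewrite gt_eqF// sqrtr_gt0.
have d1 :
    is_derive s 1 (fun y => (2 * Num.sqrt t)^-1 * y) (2 * Num.sqrt t)^-1.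
  by apply: (is_derive_eq (is_derive1Ml _ (is_derive_id s 1))); rewrite mulr1.
have d2 := is_derive1Ml (Num.sqrt t / 2)
  (is_derive1_comp (is_derive_heat_profile' ((2 * Num.sqrt t)^-1 * s)) d1).
rewrite (_ : heat_source_s t = fun y => Num.sqrt t / 2 *
    (heat_profile' \o (fun y => (2 * Num.sqrt t)^-1 * y)) y).
  by apply: (is_derive_eq d2); rewrite [s / _]mulrC; field.
by apply/funext => y; rewrite /heat_source_s /= [y / _]mulrC.
Qed.

(** Together with the second s-derivative, E_t - E_ss = erf - (erf - 1) = 1. *)
Lemma is_derive_heat_source_t s t : 0 < t ->
  is_derive t 1 (heat_source s) (erf (s / (2 * Num.sqrt t))).
Proof.
move=> t0; have st0 : Num.sqrt t != 0 by rewrite gt_eqF// sqrtr_gt0.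
have d1 : is_derive t 1 (fun y => s / 2 * (Num.sqrt y)^-1)
    (s / 2 * (- (Num.sqrt t) ^- 2 * (2 * Num.sqrt t)^-1)).
  exact: (is_derive1Ml _ (is_deriveV st0 (is_derive1_sqrt t0))).
have zE y : s / 2 * (Num.sqrt y)^-1 = s / (2 * Num.sqrt y).
  by rewrite invfM mulrA.
have d2 := is_derive1M (is_derive_id t 1)
  (is_derive1_comp (is_derive_heat_profile _) d1).
rewrite (_ : heat_source s =
  fun y => id y * (heat_profile \o (fun y => s / 2 * (Num.sqrt y)^-1)) y).
  apply: (is_derive_eq d2); rewrite /= mulr1 zE -heat_profile_ode addrC.
  congr (_ + _); rewrite -{1}(sqr_sqrtr (ltW t0)); by field.
by apply/funext => y; rewrite /heat_source /= zE.
Qed.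

Lemma continuous_heat_source_t s : 0 <= s -> continuous (heat_source s).
Proof.
move=> s0 t; have [t0|t0|<-] := ltgtP 0 t.
- exact: is_derive1_continuous (is_derive_heat_source_t s t0).
- apply: cvg_near_cst; near=> r.
  rewrite (heat_source_le0 s (ltW t0)) heat_source_le0//.
  by near: r; apply: (@cvgr_le _ _ _ _ id t); [exact: cvg_id|].
- apply/cvgrPdist_le => e e0; near=> r.
  rewrite heat_source_le0// sub0r normrN (le_trans (heat_source_bound _ s0))//.
  rewrite -ler_pdivlMl// -[r]opprK normrN -[- r]add0r; near: r.
  by apply: cvgr_dist_le; [exact: cvg_id|rewrite mulr_gt0// invr_gt0].
Unshelve. all: by end_near. Qed.

(** For t > 0, E_t = erf(s / (2 sqrt t)) lies between 0 and (2 / sqrt pi) s / (2 sqrt t), the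
    t-derivative of (2 / sqrt pi) s sqrt t. These square-root increments later become the singular
    integral. *)
Lemma heat_source_incr s a b : 0 <= s -> a <= b ->
  0 <= heat_source s b - heat_source s a
    <= 2 / Num.sqrt pi * s * (Num.sqrt b - Num.sqrt a).
Proof.
move=> s0.
(* A negative endpoint may be replaced by 0, because [Num.sqrt] and [heat_source s] both vanish on
   negative times. *)
wlog a0 : a b / 0 <= a => [H|] ab.
  have [a0|a0] := leP 0 a; first exact: H.
  have [b0|b0] := leP 0 b.
    have := H 0 b (lexx _) b0.
    by rewrite sqrtr0 (ler0_sqrtr (ltW a0)) (heat_source_le0 s (ltW a0))
      (heat_source_le0 s (lexx 0)).
  rewrite (ler0_sqrtr (ltW a0)) (heat_source_le0 s (ltW a0)).
  rewrite (ler0_sqrtr (ltW b0)) (heat_source_le0 s (ltW b0)).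
  by rewrite !subrr mulr0 lexx.
have ec := continuous_subspaceT (continuous_heat_source_t s0).
have dE c : c \in `]a, b[ ->
    is_derive c 1 (heat_source s) (erf (s / (2 * Num.sqrt c))).
  rewrite in_itv/= => /andP[ac _]; apply: is_derive_heat_source_t.
  exact: le_lt_trans ac.
have z0 c : 0 <= s / (2 * Num.sqrt c).
  by rewrite divr_ge0// mulr_ge0// sqrtr_ge0.
apply/andP; split.
  have [c _ ->] := MVT_segment ab dE (ec _).
  by rewrite mulr_ge0 ?erf_ge0// subr_ge0.
pose k : R := 2 / Num.sqrt pi * s.
pose D y := k * Num.sqrt y - heat_source s y.
have dD c : c \in `]a, b[ ->
    is_derive c 1 D (k * (2 * Num.sqrt c)^-1 - erf (s / (2 * Num.sqrt c))).
  move=> cab; apply: is_derive1B (dE _ cab); apply: is_derive1Ml.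
  apply: is_derive1_sqrt.
  by move: cab; rewrite in_itv/= => /andP[ac _]; exact: le_lt_trans ac.
have cD : {within `[a, b], continuous D}.
  apply: continuous_subspaceT => x; apply: cvgB.
    by apply: cvgM; [exact: cvg_cst|exact: sqrt_continuous].
  exact: continuous_heat_source_t.
have [c _ h] := MVT_segment ab dD cD.
have : 0 <= D b - D a.
  rewrite h mulr_ge0 ?subr_ge0// (le_trans (erf_le (z0 _)))//.
  by rewrite /k mulrA.
by rewrite /D /k; lra.
Qed.

(** Near (0, 0) the argument s / (2 sqrt t) has no limit; there the bound 3 |t|, uniform in s >= 0,
    gives the continuity. *)
Lemma continuous_heat_source :
  {within [set p : R * R | 0 <= p.1],
    continuous (fun p => heat_source p.1 p.2)}.
Proof.
apply/subspace_continuousP => -[s t] /= s0; rewrite /from_subspace /=.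
have [t0|t0|<-] := ltgtP 0 t.
- apply: cvg_within_filter.
  have st0 : 2 * Num.sqrt t != 0 by rewrite mulf_neq0// gt_eqF// sqrtr_gt0.
  apply: cvgM; first exact: cvg_snd.
  apply: (cvg_comp (fun p : R * R => p.1 / (2 * Num.sqrt p.2)));
    last exact: continuous_heat_profile.
  apply: cvgM; first exact: cvg_fst.
  apply: cvgV => //; apply: cvgM; first exact: cvg_cst.
  apply: (cvg_comp (fun p : R * R => p.2)); first exact: cvg_snd.
  exact: sqrt_continuous.
- apply: cvg_within_filter; apply: cvg_near_cst.
  near=> p; rewrite (heat_source_le0 s (ltW t0)) heat_source_le0//.
  near: p.
  have : (fun p : R * R => p.2) p @[p --> (s, t)] --> t by exact: cvg_snd.
  by move=> /cvgr_le; apply.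
- apply/cvgrPdist_le => e e0; near=> p.
  rewrite (heat_source_le0 s (lexx 0)).
  have p0 : 0 <= p.1 by near: p; exact: withinT.
  rewrite sub0r normrN (le_trans (heat_source_bound _ p0))//.
  rewrite -ler_pdivlMl// -[p.2]opprK normrN -[- p.2]add0r; near: p.
  apply: cvg_within.
  have /cvgr_dist_le : (fun p : R * R => p.2) p @[p --> (s, 0)] --> (0 : R).
    exact: cvg_snd.
  by apply; rewrite mulr_gt0// invr_gt0.
Unshelve. all: by end_near. Qed.

End heat_source.

(** * The heat operator with left time derivative, and the minimum principle *)

Section heat_operator.
Context {R : realType}.
Implicit Types (f g : R -> R) (w : R * R -> R) (a b c l r s t : R).

(** A left derivative is what exists at the final time and at the times when a source is switched
    on, and its sign at a minimum is enough for the minimum principle. *)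
Definition left_derive f t a :=
  (r - t)^-1 * (f r - f t) @[r --> t^'-] --> a.

Lemma left_deriveD f g t a b : left_derive f t a -> left_derive g t b ->
  left_derive (fun x => f x + g x) t (a + b).
Proof.
rewrite /left_derive => df dg.
rewrite (_ : (fun r => _) = (fun r => (r - t)^-1 * (f r - f t)) \+
    (fun r => (r - t)^-1 * (g r - g t))); first exact: cvgD.
by apply/funext => r /=; ring.
Qed.

Lemma left_deriveMl f t a c : left_derive f t a ->
  left_derive (fun x => c * f x) t (c * a).
Proof.
rewrite /left_derive => df.
rewrite (_ : (fun r => _) = (fun r => c * ((r - t)^-1 * (f r - f t)))).
  by apply: cvgM => //; exact: cvg_cst.
by apply/funext => r /=; ring.
Qed.

Lemma left_derive_is_derive f t a : is_derive t 1 f a -> left_derive f t a.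
Proof.
move=> /is_derive1_caratheodory[g [fg cg <-]].
have : g r @[r --> t^'-] --> g t by exact: cvg_at_left_filter cg.
apply: cvg_trans; apply: near_eq_cvg; near=> r.
by rewrite fg mulrC mulfK// subr_eq0 lt_eqF.
Unshelve. all: by end_near. Qed.

Lemma left_derive_near f g t a : f t = g t ->
  (\forall r \near t^'-, f r = g r) ->
  left_derive f t a -> left_derive g t a.
Proof.
move=> ft fg; apply: cvg_trans; apply: near_eq_cvg; near=> r.
by rewrite ft; congr (_ * (_ - _)); near: r.
Unshelve. all: by end_near. Qed.

Lemma left_derive_le0 f t a : left_derive f t a ->
  (\forall r \near t^'-, f t <= f r) -> a <= 0.
Proof.
move=> df fmin; apply: (cvgr_to_le df); near=> r.
rewrite mulr_le0_ge0// ?subr_ge0; last by near: r; exact: fmin.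
by rewrite invr_le0 subr_le0 ltW//; near: r; exact: nbhs_left_lt.
Unshelve. all: by end_near. Qed.

(** At the interior minimum f1 s = 0. If b < 0, then f1 < 0 just to the right of s, and the mean
    value theorem puts f below its minimum. *)
Lemma second_derive_min_ge0 f f1 l s b : 0 < s < l ->
  (forall y, 0 < y < l -> is_derive y 1 f (f1 y)) -> is_derive s 1 f1 b ->
  (forall y, 0 < y < l -> f s <= f y) -> 0 <= b.
Proof.
move=> /[dup] /andP[s0 sl] s0l df df1 fmin.
have f1s : f1 s = 0.
  have : is_derive s 1 f 0.
    apply: (@derive1_at_min _ f 0 l s); rewrite ?in_itv//=.
    - by rewrite ltW// (lt_trans s0).
    - by move=> y; rewrite in_itv/= => /df[].
  by move=> [_ <-]; have [_ <-] := df _ s0l.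
rewrite leNgt; apply/negP => b0.
have [g [fg cg gs]] := (is_derive1_caratheodory _ _ _).1 df1.
have /cvgr_lt/(_ _ b0) : g y @[y --> s] --> b by rewrite -gs.
move=> /nbhs_ballP[d /= d0 dg].
(* A point to the right of s, still below l and inside the ball where the slope of [f1] is
   negative. *)
pose y := s + Num.min (d / 2) ((l - s) / 2).
have m0 : 0 < Num.min (d / 2) ((l - s) / 2).
  by rewrite lt_min !divr_gt0// subr_gt0.
have md : Num.min (d / 2) ((l - s) / 2) <= d / 2 by rewrite ge_min lexx.
have ml : Num.min (d / 2) ((l - s) / 2) <= (l - s) / 2.
  by rewrite ge_min lexx orbT.
have sy : s < y by rewrite /y ltrDl.
have yd : y < s + d by rewrite /y; lra.
have yl : y < l by rewrite /y; lra.
have dfy c : c \in `]s, y[ -> is_derive c 1 f (f1 c).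
  rewrite in_itv/= => /andP[sc cy]; apply: df.
  by rewrite (lt_trans s0)//= (lt_trans cy).
have [|c] := MVT sy dfy.
  apply: derivable_within_continuous => c; rewrite in_itv/= => /andP[sc cy].
  have [] // := df c _.
  by rewrite (lt_le_trans s0)//= (le_lt_trans cy).
rewrite in_itv/= => /andP[sc cy] fE.
have : f y < f s.
  rewrite -subr_lt0 fE pmulr_llt0 ?subr_gt0//.
  have := fg c; rewrite f1s subr0 => ->.
  rewrite pmulr_llt0 ?subr_gt0//; apply: dg.
  rewrite /ball/= distrC gtr0_norm ?subr_gt0// ltrBlDl.
  exact: lt_trans yd.
by rewrite ltNge fmin// yl (lt_trans s0).
Qed.

(** Reads: w_t - w_ss = r at (s, t). The witness [w1] for w_s lives on all of (0, l), as the
    second-derivative test at a minimum requires; a relation rather than a value makes linear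
    combinations immediate. *)
Definition heat_at l w s t r := exists a b, exists w1 : R -> R,
  [/\ left_derive (fun x => w (s, x)) t a,
      forall y, 0 < y < l -> is_derive y 1 (fun x => w (x, t)) (w1 y),
      is_derive s 1 w1 b & a - b = r].

Lemma heat_atD l w w' s t r r' : heat_at l w s t r -> heat_at l w' s t r' ->
  heat_at l (fun p => w p + w' p) s t (r + r').
Proof.
move=> [a [b [w1 [wt w1E w2 <-]]]] [a' [b' [w1' [wt' w1E' w2' <-]]]].
exists (a + a'), (b + b'), (fun y => w1 y + w1' y); split.
- exact: left_deriveD.
- by move=> y yl; apply: is_derive1D; [exact: w1E|exact: w1E'].
- exact: is_derive1D.
- by ring.
Qed.

Lemma heat_atMl l w s t r c : heat_at l w s t r ->
  heat_at l (fun p => c * w p) s t (c * r).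
Proof.
move=> [a [b [w1 [wt w1E w2 <-]]]].
exists (c * a), (c * b), (fun y => c * w1 y); split.
- exact: left_deriveMl.
- by move=> y yl; apply: is_derive1Ml; exact: w1E.
- exact: is_derive1Ml.
- by ring.
Qed.

Lemma heat_at_ext l w w' s t r : w =1 w' -> heat_at l w s t r ->
  heat_at l w' s t r.
Proof. by move=> /funext ->. Qed.

Lemma heat_at_linear l s t c : heat_at l (fun p => c * p.1) s t 0.
Proof.
exists 0, 0, (fun=> c); split => /=.
- by apply: left_derive_is_derive; exact: is_derive1_cst.
- move=> y _; apply: (is_derive_eq (is_derive1Ml c (is_derive_id y 1))).
  by rewrite mulr1.
- exact: is_derive1_cst.
- by rewrite subrr.
Qed.

(** The coefficient 3 beats the 2 coming from (s^2)_ss, which makes this term a strict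
    supersolution. *)
Lemma heat_at_quadratic l s t : heat_at l (fun p => p.1 ^+ 2 + 3 * p.2) s t 1.
Proof.
exists 3, 2, (fun y => 2 * y); split => /=.
- apply: left_derive_is_derive; apply: (is_derive_eq
    (is_derive1D (is_derive1_cst t _) (is_derive1Ml 3 (is_derive_id t 1)))).
  by rewrite add0r mulr1.
- move=> y _; apply: (is_derive_eq
    (is_derive1D (is_derive1_sqr y) (is_derive1_cst y _))).
  by rewrite addr0.
- apply: (is_derive_eq (is_derive1Ml 2 (is_derive_id s 1))).
  by rewrite mulr1.
- by ring.
Qed.

(** The inequality a < t is strict because at t = a the left derivative still sees the zero
    extension. *)
Lemma heat_at_source l s t a :
  heat_at l (fun p => heat_source p.1 (p.2 - a)) s t (a < t)%R%:R.
Proof.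
have [at0|ta] := ltP a t.
  have ta0 : 0 < t - a by rewrite subr_gt0.
  pose e := erf (s / (2 * Num.sqrt (t - a))).
  exists e, (e - 1), (heat_source_s (t - a)); split => /=.
  - apply: left_derive_is_derive.
    have dB : is_derive t 1 (fun x => x - a) 1.
      apply: (is_derive_eq
        (is_derive1B (is_derive_id t 1) (is_derive1_cst t a))).
      by rewrite subr0.
    apply: (is_derive_eq (@is_derive1_comp _ (heat_source s) (fun x => x - a)
      _ _ _ (is_derive_heat_source_t s ta0) dB)).
    by rewrite mulr1.
  - by move=> y _; exact: is_derive_heat_source_s.
  - exact: is_derive_heat_source_ss.
  - by rewrite opprB addrC subrK.
exists 0, 0, (fun=> 0); split => /=.
- have := left_derive_is_derive (is_derive1_cst t (0 : R)).
  apply: left_derive_near; first by rewrite heat_source_le0// subr_le0.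
  by near=> r; rewrite heat_source_le0// subr_le0 (le_trans _ ta).
- move=> y _; rewrite (_ : (fun x => _) = fun=> 0); first exact: is_derive1_cst.
  by apply/funext => x; rewrite heat_source_le0// subr_le0.
- exact: is_derive1_cst.
- by rewrite subrr.
Unshelve. all: by end_near. Qed.

(** At a minimum with 0 < s < l and positive time, the left time derivative is at most 0 and w_ss is
    at least 0, against w_t - w_ss > 0. Hence the minimum sits on the bottom or lateral edges. *)
Lemma heat_minimum_principle l t w : 0 < l -> 0 < t ->
  {within `[0, l] `*` `[0, t], continuous w} ->
  (forall s, 0 <= s <= l -> 0 <= w (s, 0)) ->
  (forall r, 0 <= r <= t -> 0 <= w (0, r) /\ 0 <= w (l, r)) ->
  (forall s r, 0 < s < l -> 0 < r <= t ->
    exists2 c, 0 < c & heat_at l w s r c) ->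
  forall s r, 0 <= s <= l -> 0 <= r <= t -> 0 <= w (s, r).
Proof.
move=> l0 t0 cw w0 wb wh s r sl rt.
have cK : compact (`[0, l] `*` `[0, t]).
  by apply: compact_setX; exact: segment_compact.
have [|[s' r'] + wmin] := compact_EVT_min _ cK cw.
  by exists (s, r); split; rewrite /= in_itv.
rewrite inE /= !in_itv/= => -[s'l r't].
apply: (@le_trans _ _ (w (s', r'))); last first.
  by apply: wmin; rewrite inE; split; rewrite /= in_itv.
have [r'0|r'0] := leP r' 0.
  have -> : r' = 0 by apply/eqP; rewrite eq_le r'0; case/andP: r't.
  exact: w0.
have [s'0|s'0] := leP s' 0.
  have -> : s' = 0 by apply/eqP; rewrite eq_le s'0; case/andP: s'l.
  by have [] := wb _ r't.
have [ls'|ls'] := leP l s'.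
  have -> : s' = l by apply/eqP; rewrite eq_le ls' andbT; case/andP: s'l.
  by have [] := wb _ r't.
have s'l' : 0 < s' < l by rewrite s'0.
have [|c c0 [a [b [w1 [wt w1E w2 abc]]]]] := wh s' r' s'l'.
  by rewrite r'0; case/andP: r't.
have a0 : a <= 0.
  apply: (left_derive_le0 wt); near=> x; apply: wmin; rewrite inE.
  split; rewrite /= in_itv/=; first by [].
  apply/andP; split.
    by near: x; apply: nbhs_left_ge.
  case/andP: r't => _; apply: le_trans.
  by near: x; exact: nbhs_left_le.
have b0 : 0 <= b.
  apply: (second_derive_min_ge0 s'l' w1E w2) => y /andP[y0 yl].
  by apply: wmin; rewrite inE; split; rewrite /= in_itv//= !ltW.
by move: c0; rewrite -abc; lra.
Unshelve. all: by end_near. Qed.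

End heat_operator.

(** * The barrier and the comparison estimate *)

Section comparison.
Context {R : realType}.
Implicit Types (w : R * R -> R) (s t l r a : R).

Lemma heat_at_sum n (w : nat -> R * R -> R) l s t (r : nat -> R) :
  (forall k, heat_at l (w k) s t (r k)) ->
  heat_at l (fun p => \sum_(k < n) w k p) s t (\sum_(k < n) r k).
Proof.
move=> wr; elim: n => [|n IH].
  rewrite big_ord0; apply: (heat_at_ext _ (heat_at_linear l s t 0)) => p.
  by rewrite big_ord0 mul0r.
rewrite big_ord_recr; apply: (heat_at_ext _ (heat_atD IH (wr n))) => p.
by rewrite big_ord_recr.
Qed.

Lemma within_continuous_comp_pair (K A : set (R * R)) (h1 h2 : R * R -> R)
    (g : R * R -> R) :
  continuous h1 -> continuous h2 -> (forall p, K p -> A (h1 p, h2 p)) ->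
  {within A, continuous g} -> {within K, continuous (fun p => g (h1 p, h2 p))}.
Proof.
move=> ch1 ch2 KA /subspace_continuousP cg.
apply/subspace_continuousP => p Kp.
apply: (cvg_comp (fun q => (h1 q, h2 q)) _ _ (cg _ (KA _ Kp))).
have ch : (h1 q, h2 q) @[q --> p] --> (h1 p, h2 p).
  apply: (@cvg_pair _ _ _ (nbhs p) (nbhs (h1 p)) (nbhs (h2 p)) _ _ _ h1 h2).
    exact: ch1.
  exact: ch2.
move=> U WU; change (nbhs p [set q | K q -> U (h1 q, h2 q)]).
by apply: (@filterS _ (nbhs p) (nbhs_filter _) _ _ _ (ch _ WU)) => q Uq Kq;
  apply: Uq; exact: KA.
Qed.

Lemma continuous_heat_source_shift a (K : set (R * R)) :
  (forall p, K p -> 0 <= p.1) ->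
  {within K, continuous (fun p => heat_source p.1 (p.2 - a))}.
Proof.
move=> K0; apply: (@within_continuous_comp_pair K [set p | 0 <= p.1] fst
  (fun p => p.2 - a) (fun p => heat_source p.1 p.2)) => //.
- by move=> p; exact: cvg_fst.
- by move=> p; apply: cvgB; [exact: cvg_snd|exact: cvg_cst].
- exact: continuous_heat_source.
Qed.

Lemma within_continuous_sum n (f : nat -> R * R -> R) (K : set (R * R)) :
  (forall k, {within K, continuous (f k)}) ->
  {within K, continuous (fun p => \sum_(k < n) f k p)}.
Proof.
move=> cf; elim: n => [|n IH].
  under eq_fun do rewrite big_ord0.
  by apply: continuous_subspaceT => p; exact: cvg_cst.
under eq_fun do rewrite big_ord_recr/=.
by move=> p; apply: cvgD; [exact: IH|exact: cf].
Qed.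

(** The linear term dominates the initial data. The k-th difference carries the source c k on d k <
    t <= d k.+1 only. The quadratic term dominates at the far edge s = l and makes the inequality
    strict. *)
Definition heat_barrier n (d c : nat -> R) (L M : R) (p : R * R) : R :=
  L * p.1 + \sum_(k < n) c k *
    (heat_source p.1 (p.2 - d k) - heat_source p.1 (p.2 - d k.+1)) +
  M * (p.1 ^+ 2 + 3 * p.2).

Lemma heat_at_barrier n (d c : nat -> R) (L M : R) l s t :
  heat_at l (heat_barrier n d c L M) s t
    (\sum_(k < n) c k * ((d k < t)%R%:R - (d k.+1 < t)%R%:R) + M).
Proof.
have h k : heat_at l (fun p => c k *
    (heat_source p.1 (p.2 - d k) - heat_source p.1 (p.2 - d k.+1))) s t
    (c k * ((d k < t)%R%:R - (d k.+1 < t)%R%:R)).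
  apply: heat_atMl; rewrite -mulN1r.
  apply: (heat_at_ext _ (heat_atD (heat_at_source l s t (d k))
    (heat_atMl (-1) (heat_at_source l s t (d k.+1))))) => p.
  by rewrite mulN1r.
rewrite -[X in heat_at _ _ _ _ (X + M)]add0r.
rewrite -[M in X in heat_at _ _ _ _ X]mulr1.
exact: heat_atD (heat_atD (heat_at_linear l s t L) (heat_at_sum n h))
  (heat_atMl M (heat_at_quadratic l s t)).
Qed.

Lemma continuous_heat_barrier n (d c : nat -> R) (L M : R) (K : set (R * R)) :
  (forall p, K p -> 0 <= p.1) ->
  {within K, continuous (heat_barrier n d c L M)}.
Proof.
move=> K0 p.
have c1 : {within K, continuous (fun p : R * R => p.1)}.
  by apply: continuous_subspaceT => q; exact: cvg_fst.
have c2 : {within K, continuous (fun p : R * R => p.2)}.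
  by apply: continuous_subspaceT => q; exact: cvg_snd.
apply: cvgD; last first.
  apply: cvgM; first exact: cvg_cst.
  apply: cvgD; last by apply: cvgM; [exact: cvg_cst|exact: c2].
  by apply: cvgM; exact: c1.
apply: cvgD; first by apply: cvgM; [exact: cvg_cst|exact: c1].
apply: (@within_continuous_sum n (fun k p => c k *
  (heat_source p.1 (p.2 - d k) - heat_source p.1 (p.2 - d k.+1)))) => k q.
apply: cvgM; first exact: cvg_cst.
by apply: cvgB; exact: continuous_heat_source_shift.
Qed.

Lemma heat_comparison n (d c : nat -> R) (L C l t : R) v :
  0 < l -> 0 < t -> 0 <= L -> 0 < C ->
  {homo d : i j / (i <= j)%N >-> i <= j} -> d 0%N = 0 -> d n = t ->
  (forall k, 0 <= c k) ->
  {within `[0, l] `*` `[0, t], continuous v} ->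
  (forall s, 0 <= s <= l -> v (s, 0) <= L * s) ->
  (forall r, 0 <= r <= t -> v (0, r) <= 0 /\ v (l, r) <= C) ->
  (forall s r k, 0 < s < l -> (k < n)%N -> d k < r <= d k.+1 ->
    exists2 b, b <= c k & heat_at l v s r b) ->
  forall s, 0 <= s <= l -> v (s, t) <=
    L * s + 2 / Num.sqrt pi * s *
      \sum_(k < n) c k * (Num.sqrt (t - d k) - Num.sqrt (t - d k.+1)) +
    C / l ^+ 2 * (s ^+ 2 + 3 * t).
Proof.
move=> l0 t0 L0 C0 dhomo d0 dn c0 cv v0 vb vh s sl.
(* Chosen so that M l^2 = C, the bound on v at the far edge. *)
pose M := C / l ^+ 2; have M0 : 0 < M by rewrite divr_gt0// exprn_gt0.
pose K : set (R * R) := `[0, l] `*` `[0, t].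
have K0 p : K p -> 0 <= p.1 by case=> /=; rewrite in_itv/= => /andP[].
have dd k : d k <= d k.+1 by exact: dhomo.
have sum0 x r : 0 <= x -> 0 <= \sum_(k < n) c k *
    (heat_source x (r - d k) - heat_source x (r - d k.+1)).
  move=> x0; apply: sumr_ge0 => k _; rewrite mulr_ge0//.
  by have /andP[] := @heat_source_incr R x (r - d k.+1) (r - d k) x0
    (lerB (lexx r) (dd k)).
pose w p := heat_barrier n d c L M p + (-1) * v p.
have /(_ s t sl) : forall s r, 0 <= s <= l -> 0 <= r <= t -> 0 <= w (s, r).
  apply: (heat_minimum_principle l0 t0).
  - move=> p; apply: cvgD; first exact: continuous_heat_barrier.
    by apply: cvgM; [exact: cvg_cst|exact: cv].
  - move=> x /[dup] xl /andP[x0 _]; rewrite /w mulN1r subr_ge0.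
    apply: le_trans (v0 _ xl) _; rewrite /heat_barrier/= -addrA lerDl.
    by rewrite addr_ge0 ?sum0// mulr_ge0 ?(ltW M0)// mulr0 addr0 sqr_ge0.
  - move=> r /[dup] rt /andP[r0 _]; have [vb0 vbl] := vb _ rt.
    rewrite /w !mulN1r !subr_ge0; split.
      apply: le_trans vb0 _; rewrite /heat_barrier/= mulr0 add0r.
      by rewrite addr_ge0 ?sum0// mulr_ge0 ?(ltW M0)// expr0n add0r mulr_ge0.
    apply: le_trans vbl _; rewrite /heat_barrier/=.
    have -> : C = M * l ^+ 2 by rewrite /M divfK// expf_neq0// gt_eqF.
    rewrite mulrDr addrCA lerDl addr_ge0//.
      by rewrite addr_ge0 ?sum0 ?mulr_ge0// ltW.
    by rewrite mulr_ge0 ?(ltW M0)// mulr_ge0.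
  - move=> x r xl /andP[r0 rt].
    (* The slab containing r: k.+1 is the least index whose node is at least r, and this index is
       not 0 because d 0 = 0 < r. *)
    have [k kn dk] : exists2 k, (k < n)%N & d k < r <= d k.+1.
      have ex : exists k, r <= d k by exists n; rewrite dn.
      have := ex_minnP ex; case: ex_minnP => -[|k] rk kmin _.
        by move: rk; rewrite d0 leNgt r0.
      exists k; first by apply: kmin; rewrite dn.
      rewrite rk andbT ltNge; apply/negP => /kmin.
      by rewrite ltnn.
    have [b bc hb] := vh x r k xl kn dk.
    exists (\sum_(k < n) c k * ((d k < r)%R%:R - (d k.+1 < r)%R%:R) + M
      + (-1) * b); last first.
      exact: heat_atD (heat_at_barrier _ _ _ _ _ _ _ _) (heat_atMl _ hb).
    rewrite mulN1r subr_gt0 (le_lt_trans bc)// ltr_pwDr//.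
    (* The k-th difference of indicators is 1 and the others are nonnegative, so the sum is at least
       c k; M > 0 supplies the strictness. *)
    rewrite (bigD1 (Ordinal kn))//=; case/andP: dk => -> dk.
    rewrite (ltNge (d k.+1)) dk subr0 mulr1 lerDl sumr_ge0// => j _.
    rewrite mulr_ge0// subr_ge0 ler_nat; case: (ltP (d j.+1)) => //= dr.
    by rewrite (le_lt_trans (dd j) dr).
case/andP: sl => s0 _; rewrite (ltW t0) lexx /w mulN1r subr_ge0 => /(_ isT).
move=> /le_trans; apply; rewrite /heat_barrier /= lerD2r lerD2l.
rewrite mulr_sumr; apply: ler_sum => k _; rewrite mulrCA ler_wpM2l//.
by have /andP[] := @heat_source_incr R s (t - d k.+1) (t - d k) s0
    (lerB (lexx t) (dd k)).
Qed.

End comparison.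

(** * Lipschitz bound for the initial data *)

Section lipschitz.
Context {R : realType}.

(** Induction on the list of exceptional points: the interval is split at the head whenever that
    point is interior, and the two estimates add up. *)
Lemma MVT_le_except (g : R -> R) (L : R) (S : seq R) : continuous g ->
  forall a b, a <= b ->
  (forall x, a < x < b -> x \notin S ->
    derivable g x 1 /\ `|derive1 g x| <= L) ->
  `|g b - g a| <= L * (b - a).
Proof.
move=> cg; elim: S => [|x S IH] a b ab dg.
  have dg' c : c \in `]a, b[ -> is_derive c 1 g (derive1 g c).
    rewrite in_itv/= => /dg[]// dgc _.
    by rewrite derive1E; exact: derivableP.
  move: ab; rewrite le_eqVlt => /predU1P[->|ab].
    by rewrite !subrr normr0 mulr0.
  have [c cab ->] := MVT ab dg' (continuous_subspaceT cg).
  rewrite normrM (gtr0_norm (x := b - a)) ?subr_gt0// ler_pM2r ?subr_gt0//.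
  by have [] := dg c _ _; first by move: cab; rewrite in_itv.
have [xab|xab] := boolP (a < x < b); last first.
  apply: IH => // y yab yS; apply: dg => //; rewrite inE negb_or yS andbT.
  by apply: contra xab => /eqP <-.
case/andP: xab => ax xb.
have h1 : `|g x - g a| <= L * (x - a).
  apply: IH; first exact: ltW.
  move=> y /andP[ay yx] yS; apply: dg; first by rewrite ay (lt_trans yx).
  by rewrite inE negb_or yS andbT lt_eqF.
have h2 : `|g b - g x| <= L * (b - x).
  apply: IH; first exact: ltW.
  move=> y /andP[xy yb] yS; apply: dg; first by rewrite yb (lt_trans ax).
  by rewrite inE negb_or yS andbT gt_eqF.
rewrite -(subrKA (g x)) -(subrKA x b) mulrDr.
by rewrite (le_trans (ler_normD _ _))// lerD.
Qed.

Lemma BPC1_lipschitz (v : R -> R) (L : R) :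
  BPC1 v -> (normB_deriv v <= L%:E)%E ->
  forall a b, a <= b -> `|v b - v a| <= L * (b - a).
Proof.
move=> [cv _ [S [Sfin Sd _]] _] vL a b ab.
have /finite_seqP[s sE] := Sfin a b.
apply: (@MVT_le_except v L s cv a b ab) => x /andP[ax xb] xs.
have [dx _] : derivable v x 1 /\ {for x, continuous (derive1 v)}.
  apply: Sd => Sx; move/negP: xs; apply.
  have : (S `&` `[a, b]) x by split => //=; rewrite in_itv/= !ltW.
  by rewrite sE.
split => //; rewrite -lee_fin; apply: le_trans vL.
by apply: ereal_sup_ubound; exists x.
Qed.

End lipschitz.

(** * Lower bounds for the integral with kernel (t - x)^(-1/2) *)

Section singular_integral.
Context {R : realType}.
Local Notation mu := (@lebesgue_measure R).

Lemma is_derive_sqrt_sub (t x : R) : x < t ->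
  is_derive x 1 (fun y => - 2 * Num.sqrt (t - y)) (Num.sqrt (t - x))^-1.
Proof.
move=> xt; have tx : 0 < t - x by rewrite subr_gt0.
have d1 := is_derive1B (is_derive1_cst x t) (is_derive_id x 1).
have d2 := @is_derive1_comp _ Num.sqrt (fun y => t - y) _ _ _
  (is_derive1_sqrt tx) d1.
apply: (is_derive_eq (is_derive1Ml (-2) d2)).
by field; rewrite gt_eqF// sqrtr_gt0.
Qed.

Lemma continuous_sqrt_sub (t : R) : continuous (fun y => Num.sqrt (t - y)).
Proof.
move=> x; apply: (cvg_comp (fun y => t - y) Num.sqrt);
  last exact: sqrt_continuous.
by apply: cvgB; [exact: cvg_cst|exact: cvg_id].
Qed.

Lemma measurable_invsqrt_sub (t : R) (D : set R) :
  measurable_fun D (fun y => (Num.sqrt (t - y))^-1).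
Proof.
apply: measurable_funTS.
(* Both sides agree also where the root is 0: the inverse and the power -1 of 0 are both 0. *)
rewrite (_ : (fun y => _) = (@powR R ^~ (-1)) \o (fun y => Num.sqrt (t - y))).
  apply: measurableT_comp; first exact: measurable_powR.
  by apply: continuous_measurable_fun; exact: continuous_sqrt_sub.
by apply/funext => y /=; rewrite powR_inv1// sqrtr_ge0.
Qed.

(** The kernel may be singular at b = t, so the fundamental theorem is applied on [a, c] with c < b,
    and then c tends to b. *)
Lemma integral_invsqrt_ge (t a b : R) : a <= b -> b <= t ->
  ((2 * (Num.sqrt (t - a) - Num.sqrt (t - b)))%:E <=
   \int[mu]_(x in `[a, b[) ((Num.sqrt (t - x))^-1)%:E)%E.
Proof.
rewrite le_eqVlt => /predU1P[<- _|ab bt].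
  by rewrite subrr mulr0 integral_ge0.
set I := integral _ _ _.
pose G y := - 2 * Num.sqrt (t - y).
have H c : a < c -> c < b -> ((G c - G a)%:E <= I)%E.
  move=> ac cb.
  have ct x : x <= c -> x < t by move=> xc; lra.
  have cG : continuous G.
    by move=> x; apply: cvgM; [exact: cvg_cst|exact: continuous_sqrt_sub].
  have <- : (\int[mu]_(x in `[a, c]) ((Num.sqrt (t - x))^-1)%:E =
      (G c - G a)%:E)%E.
    rewrite (@continuous_FTC2 _ _ G)//.
    - apply: continuous_in_subspaceT => x; rewrite inE/= in_itv/=.
      move=> /andP[_ xc]; apply: cvgV; last exact: continuous_sqrt_sub.
      by rewrite gt_eqF// sqrtr_gt0 subr_gt0 ct.
    - split.
      + move=> x; rewrite in_itv/= => /andP[_ xc].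
        by have [] := is_derive_sqrt_sub (ct _ (ltW xc)).
      + exact/cvg_at_right_filter/cG.
      + exact/cvg_at_left_filter/cG.
    - move=> x; rewrite in_itv/= => /andP[_ xc]; rewrite derive1E.
      by have [_ ->] := is_derive_sqrt_sub (ct _ (ltW xc)).
  apply: ge0_subset_integral => //.
  - by apply/measurable_EFinP; exact: measurable_invsqrt_sub.
  - by move=> x /=; rewrite !in_itv/= => /andP[-> /le_lt_trans]; exact.
have -> : 2 * (Num.sqrt (t - a) - Num.sqrt (t - b)) = G b - G a.
  by rewrite /G; ring.
have : (0 <= I)%E.
  by apply: integral_ge0 => x _; rewrite lee_fin invr_ge0 sqrtr_ge0.
case: I H => [r|//|//] H _; last by rewrite leey.
have Gcvg : G c - G a @[c --> b^'-] --> G b - G a.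
  apply: cvgB; last exact: cvg_cst.
  apply: cvg_at_left_filter.
  by apply: cvgM; [exact: cvg_cst|exact: continuous_sqrt_sub].
rewrite lee_fin; apply: (cvgr_to_le Gcvg).
near=> c; rewrite -lee_fin; apply: H.
  by near: c; exact: nbhs_left_gt.
by near: c; exact: nbhs_left_lt.
Unshelve. all: by end_near. Qed.

(** The integral of a nonnegative function is a supremum over the simple functions below it, hence
    monotone by definition. This is meant for the integrand with [normB], whose measurability in
    time is not established. *)
Lemma ge0_le_integral_nonmeasurable (D : set R) (f g : R -> \bar R) :
  (forall x, D x -> (0 <= f x)%E) -> (forall x, D x -> (f x <= g x)%E) ->
  (\int[mu]_(x in D) f x <= \int[mu]_(x in D) g x)%E.
Proof.
move=> f0 fg; have g0 x : D x -> (0 <= g x)%E.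
  by move=> Dx; exact: le_trans (f0 x Dx) (fg x Dx).
rewrite !ge0_integralE//; apply: ereal_sup_le => _ /= [h hI <-].
exists h => // x.
apply: (le_trans (hI x)); rewrite /patch; case: ifPn => // /set_mem.
exact: fg.
Qed.

(** F dominates the step function with value m k on the half-open cell from d k to d k.+1; that
    function is integrated against the kernel cell by cell. *)
Lemma step_integral_ge n (d m : nat -> R) (t : R) (F : R -> \bar R) :
  {homo d : i j / (i <= j)%N >-> i <= j} -> d 0%N = 0 -> d n = t ->
  (forall k, 0 <= m k) ->
  (forall k x, (k < n)%N -> d k <= x < d k.+1 -> ((m k)%:E <= F x)%E) ->
  ((\sum_(k < n) m k * (2 * (Num.sqrt (t - d k) - Num.sqrt (t - d k.+1))))%:E <=
   \int[mu]_(x in `[0%R, t[) (F x * ((Num.sqrt (t - x))^-1)%:E))%E.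
Proof.
move=> dhomo d0 dn m0 mF.
pose q x : R := (Num.sqrt (t - x))^-1.
have q0 x : 0 <= q x by rewrite invr_ge0 sqrtr_ge0.
pose A k := `[d k, d k.+1[%classic.
pose g k x : R := m k * \1_(A k) x * q x.
have g0 k x : 0 <= g k x by rewrite !mulr_ge0// indicE.
have mA k : measurable (A k) by exact: measurable_itv.
have mg k D : measurable_fun D (g k).
  apply: measurable_funM; last exact: measurable_invsqrt_sub.
  apply: measurable_funM; first exact: measurable_cst.
  by apply: measurable_funTS; exact: measurable_indic.
apply: (@le_trans _ _ (\int[mu]_(x in `[0%R, t[) (\sum_(k < n) (g k x)%:E))%E).
  rewrite ge0_integral_sum//; last first.
  - by move=> k x _; rewrite lee_fin.
  - by move=> k; apply/measurable_EFinP; exact: mg.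
  rewrite -sumEFin; apply: lee_sum => k _.
  have At : A k `<=` `[0, t[.
    move=> x; rewrite /A/= !in_itv/= => /andP[dx xd].
    rewrite -d0 (le_trans (dhomo _ _ (leq0n k)) dx)/=.
    by rewrite (lt_le_trans xd)// -dn dhomo.
  have gE : (fun x => (g k x)%:E) =
      ((fun x => ((m k)%:E * (q x)%:E)%E) \_ (A k)).
    apply/funext => x; rewrite /g patchE indicE; case: (x \in A k).
      by rewrite mulr1 EFinM.
    by rewrite mulr0 mul0r.
  rewrite gE -integral_mkcondr setIidr// ge0_integralZl_EFin//.
  - rewrite EFinM lee_wpmul2l ?lee_fin//; apply: integral_invsqrt_ge.
      exact: dhomo.
    by rewrite -dn dhomo.
  - exact: mA.
  - by move=> x _; rewrite lee_fin.
  - by apply/measurable_EFinP; exact: measurable_invsqrt_sub.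
apply: ge0_le_integral_nonmeasurable => x.
  by move=> _; apply: sume_ge0 => k _; rewrite lee_fin.
rewrite /= in_itv/= => /andP[x0 xt].
rewrite sumEFin -mulr_suml EFinM lee_wpmul2r ?lee_fin//.
(* The cells are disjoint, so at x at most one summand survives. Induction on k: either x lies in
   the last cell and the earlier indicators vanish, or the last one vanishes. *)
have step k : (k <= n)%N -> x < d k ->
    ((\sum_(i < k) m i * \1_(A i) x)%:E <= F x)%E.
  elim: k => [|k IH] kn xk; first by move: xk; rewrite d0 ltNge x0.
  rewrite big_ord_recr/= indicE; have [xdk|dkx] := ltP x (d k).
    rewrite memNset ?mulr0 ?addr0; first by apply: IH => //; exact: ltnW.
    by rewrite /A/= in_itv/= leNgt xdk.
  rewrite mem_set ?mulr1; last by rewrite /A/= in_itv/= dkx xk.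
  rewrite big1 ?add0r; first by apply: mF => //; rewrite dkx xk.
  move=> i _; rewrite indicE memNset ?mulr0// /A/= in_itv/= => /andP[_].
  by rewrite ltNge (le_trans _ dkx)// dhomo.
by apply: step => //; rewrite dn.
Qed.

End singular_integral.

(** * Time slabs on which f(u) is nearly constant in time over a compact window *)

Section partition.
Context {R : realType}.

Lemma uniformly_continuous_time (K : set R) (t e : R) (g : R * R -> R) :
  0 < e -> compact K -> {within K `*` `[0, t], continuous g} ->
  exists2 d, 0 < d & forall y r r', K y -> 0 <= r <= t -> 0 <= r' <= t ->
    `|r - r'| <= d -> `|g (y, r) - g (y, r')| <= e.
Proof.
move=> e0 cK cg.
have cKt : compact (K `*` `[0, t]).
  by apply: compact_setX => //; exact: segment_compact.
have e20 : 0 < e / 2 by rewrite divr_gt0.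
pose P (d : R) (p : R * R) := forall r, 0 <= r <= t -> `|p.2 - r| <= d ->
  `|g p - g (p.1, r)| <= e.
have : \forall d \near 0^'+, K `*` `[0, t] `<=` P d.
  have /compact_near_coveringP/near_covering_withinP := cKt.
  apply => -[y r] /= [Ky rt].
  have /subspace_continuousP/(_ (y, r) (conj Ky rt)) := cg.
  move=> /cvgrPdist_le/(_ _ e20); rewrite near_withinE => /nbhs_ballP[d /= d0 dg].
  have d20 : 0 < d / 2 by rewrite divr_gt0.
  (* Half the radius leaves room to move the time by d' < d / 2 and stay within d of the centre. *)
  exists (ball (y, r) (d / 2), [set d' | d' < d / 2]); first split => /=.
  - exact: nbhsx_ballx.
  - exact: nbhs_right_lt.
  move=> [[y' r'] d'] /= [[/= yy' rr'] d'd] [Ky' r't] r'' r''t r'r''.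
  have b1 : ball (y, r) d (y', r').
    by split => /=; [apply: le_ball yy'|apply: le_ball rr']; lra.
  have b2 : ball (y, r) d (y', r'').
    split => /=; first by apply: le_ball yy'; lra.
    rewrite /ball/= -(subrKA r') (le_lt_trans (ler_normD _ _))//.
    by move: rr' r'r''; rewrite /ball/=; lra.
  have := dg _ b1 (conj Ky' r't).
  have := dg _ b2 (conj Ky' _); rewrite /= in_itv/= => /(_ r''t) h2 h1.
  rewrite -(subrKA (g (y, r))) (le_trans (ler_normD _ _))//.
  by rewrite [`|g (y', r') - _|]distrC; lra.
move=> KP; near (0 : R)^'+ => d.
have Kd : K `*` `[0, t] `<=` P d by near: d.
exists d => // y r r' Ky rt r't rr'.
by apply: (Kd (y, r)) => //; split; rewrite //= in_itv.
Unshelve. all: by end_near. Qed.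

(** N stands for the sup norm over the whole line and g for f(u). Uniform continuity of g in time on
    the window K bounds N from below on a whole cell, with no regularity of N itself. *)
Lemma cell_partition (K : set R) (t e : R) (g : R * R -> R) (N : R -> \bar R) :
  0 < t -> 0 < e -> K !=set0 -> compact K ->
  {within K `*` `[0, t], continuous g} ->
  (forall r, 0 <= r <= t -> (0 <= N r)%E) ->
  (forall y r, 0 <= r <= t -> (`|g (y, r)|%:E <= N r)%E) ->
  exists (n : nat) (d m : nat -> R), [/\ {homo d : i j / (i <= j)%N >-> i <= j},
    d 0%N = 0, d n = t, (forall k, 0 <= m k) &
    forall k r, (k < n)%N -> d k <= r <= d k.+1 ->
      ((m k)%:E <= N r)%E /\ forall y, K y -> `|g (y, r)| <= m k + e].
Proof.
move=> t0 e0 K0 cK cg N0 gN.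
have [del del0 unif] := uniformly_continuous_time e0 cK cg.
(* This many equal cells have length at most [del]. *)
pose n := (Num.truncn (t / del)).+1.
have n0 : 0 < n%:R :> R by rewrite ltr0n.
have tn : t / n%:R <= del.
  rewrite ler_pdivrMr// mulrC -ler_pdivrMr//; apply: ltW; exact: truncnS_gt.
pose d k : R := t / n%:R * k%:R.
have d_homo : {homo d : i j / (i <= j)%N >-> i <= j}.
  by move=> i j ij; rewrite ler_wpM2l ?ler_nat// divr_ge0// ltW.
have dn : d n = t by rewrite /d divfK// gt_eqF.
have dSE k : d k.+1 = d k + t / n%:R by rewrite /d -natr1 mulrDr mulr1.
have cell k : exists m, 0 <= m /\ ((k < n)%N -> forall r, d k <= r <= d k.+1 ->
    (m%:E <= N r)%E /\ forall y, K y -> `|g (y, r)| <= m + e).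
  (* Past the last cell, 0 is a filler that keeps every value nonnegative. *)
  have [kn|] := boolP (k < n)%N; last by exists 0.
  have sub r : d k <= r <= d k.+1 -> 0 <= r <= t.
    move=> /andP[dr rd]; rewrite (le_trans _ dr)/=; last first.
      by rewrite /d mulr_ge0// divr_ge0// ltW.
    by rewrite (le_trans rd)// -dn d_homo.
  have dd : d k <= d k.+1 by exact: d_homo.
  have [|||[y r] + gmax] := @compact_EVT_max _ _ (fun p => `|g p|)
      (K `*` `[d k, d k.+1]).
  - by case: K0 => y Ky; exists (y, d k); split; rewrite //= in_itv/= lexx.
  - by apply: compact_setX => //; exact: segment_compact.
  - apply: (@continuous_subspaceW _ _ _ (K `*` `[0, t])).
      move=> [y r] /= [Ky]; rewrite in_itv/= => /sub rt.
      by split; rewrite //= in_itv.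
    by move=> p; apply: cvg_norm; exact: cg.
  rewrite inE => -[/= Ky]; rewrite in_itv/= => rk.
  (* The maximum of |g| over K and the cell, lowered by e: moving the time of the maximizer within
     the cell changes g by at most e, so N stays above this value throughout the cell. *)
  exists (Num.max 0 (`|g (y, r)| - e)); split; first by rewrite le_max lexx.
  move=> _ r' r'k; split.
    rewrite EFin_max ge_max N0 ?sub//= (le_trans _ (gN y _ (sub _ r'k)))//.
    rewrite lee_fin lerBlDr -lerBlDl (le_trans (lerB_dist _ _))//.
    apply: unif; rewrite ?sub//.
    apply: le_trans tn; move: rk r'k; rewrite dSE => /andP[? ?] /andP[? ?].
    by rewrite ler_norml; lra.
  move=> y' Ky'; apply: (@le_trans _ _ `|g (y, r)|).
    by apply: gmax; rewrite inE; split; rewrite //= in_itv.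
  by rewrite -lerBlDr le_max lexx orbT.
have [m mP] := choice cell.
exists n, d, m; split => //.
- by rewrite /d mulr0.
- by move=> k; have [] := mP k.
- by move=> k r kn rk; have [_] := mP k; apply.
Qed.

End partition.

(** * The equation satisfied by the odd part of a solution *)

Section solutions.
Context {R : realType}.
Implicit Types (u : R * R -> R) (T x l s t e : R).

(** Times slightly below r lie in (0, T] and differ from r, so the limit defining [dt] restricts to
    a left limit. *)
Lemma at_left_within_dnbhs T (r : R) : 0 < r <= T ->
  r^'- --> within `]0, T] r^'.
Proof.
move=> /andP[r0 rT] A; rewrite /at_left /dnbhs /within/= => hA.
change (\forall s \near r, s < r -> A s); near=> s => sr.
have : s != r -> s \in `]0, T] -> A s by near: s.
apply; first by rewrite lt_eqF.
rewrite in_itv/= (le_trans (ltW sr) rT) andbT.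
by near: s; exact: lt_nbhsr.
Unshelve. all: by end_near. Qed.

Lemma within_dnbhs_proper T (r : R) : 0 < r <= T ->
  ProperFilter (within `]0, T] r^').
Proof.
move=> rT; apply: Build_ProperFilter_ex => A /(at_left_within_dnbhs rT).
exact: filter_ex.
Qed.

Lemma cvg_dt_quotient_left T u p : strip T p -> derivable_t T u p ->
  left_derive (fun r => u (p.1, r)) p.2 (dt T u p).
Proof.
move=> pT dp; rewrite /left_derive -surjective_pairing.
by apply: cvg_trans dp; apply: cvg_app; exact: at_left_within_dnbhs.
Qed.

(** Reflection about x flips the sign of the first space derivative and keeps that of the second, so
    u(x - s, t) solves the same equation in (s, t) and the two equations can be subtracted. *)
Lemma heat_at_odd_part T f u x e l s t : C21 T u ->
  (forall p, strip T p -> dt T u p - dx (dx u) p = f (u p)) ->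
  0 < t <= T ->
  heat_at l (fun p => e * (u (x + p.1, p.2) - u (x - p.1, p.2))) s t
    (e * (f (u (x + s, t)) - f (u (x - s, t)))).
Proof.
move=> [du _ _ _] ueq tT.
have st y : strip T (y, t) by [].
have d1 (y : R) : is_derive y 1 (fun z => u (z, t)) (dx u (y, t)).
  have [_ h _] := du _ (st y).
  by rewrite /dx derive1E; exact: derivableP.
have d2 (y : R) : is_derive y 1 (fun z => dx u (z, t)) (dx (dx u) (y, t)).
  have [_ _ h] := du _ (st y).
  by rewrite {2}/dx derive1E; exact: derivableP.
have dp (y : R) : is_derive y 1 (fun z => x + z) 1.
  apply: (is_derive_eq (is_derive1D (is_derive1_cst y x) (is_derive_id y 1))).
  by rewrite add0r.
have dm (y : R) : is_derive y 1 (fun z => x - z) (-1).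
  apply: (is_derive_eq (is_derive1B (is_derive1_cst y x) (is_derive_id y 1))).
  by rewrite sub0r.
have shift1 (g g' : R -> R) : (forall y : R, is_derive y 1 g (g' y)) ->
    forall y : R, is_derive y 1 (fun z => g (x + z)) (g' (x + y)).
  move=> dg y; apply: (is_derive_eq (@is_derive1_comp _ g (fun z => x + z)
    _ _ _ (dg (x + y)) (dp y))).
  by rewrite mulr1.
have shift2 (g g' : R -> R) : (forall y : R, is_derive y 1 g (g' y)) ->
    forall y : R, is_derive y 1 (fun z => g (x - z)) (- g' (x - y)).
  move=> dg y; apply: (is_derive_eq (@is_derive1_comp _ g (fun z => x - z)
    _ _ _ (dg (x - y)) (dm y))).
  by rewrite mulrN1.
apply: heat_atMl.
exists (dt T u (x + s, t) - dt T u (x - s, t)),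
  (dx (dx u) (x + s, t) - dx (dx u) (x - s, t)),
  (fun y => dx u (x + y, t) + dx u (x - y, t)); split => /=.
- have h y : left_derive (fun r => u (y, r)) t (dt T u (y, t)).
    by have [ht _ _] := du _ (st y); exact: cvg_dt_quotient_left (st y) ht.
  have := left_deriveD (h (x + s)) (left_deriveMl (c := -1) (h (x - s))).
  rewrite mulN1r; under [X in left_derive X]eq_fun do rewrite mulN1r.
  exact.
- move=> y _.
  have h1 := shift1 (fun z => u (z, t)) (fun z => dx u (z, t)) d1 y.
  have h2 := shift2 (fun z => u (z, t)) (fun z => dx u (z, t)) d1 y.
  by apply: (is_derive_eq (is_derive1B h1 h2)); rewrite opprK.
- exact: is_derive1D
    (shift1 (fun z => dx u (z, t)) (fun z => dx (dx u) (z, t)) d2 s)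
    (shift2 (fun z => dx u (z, t)) (fun z => dx (dx u) (z, t)) d2 s).
- rewrite -(ueq _ (st (x + s))) -(ueq _ (st (x - s))).
  have swap (a b c d : R) : a - b - (c - d) = a - c - (b - d) by ring.
  exact: swap.
Qed.

End solutions.

(** * Restriction of a solution to a shorter time interval *)

Section restriction.
Context {R : realType}.
Implicit Types (u : R * R -> R) (T t : R).

Lemma restrict_cstrip u t p : 0 <= p.2 <= t -> (u \_ (cstrip t)) p = u p.
Proof. by move=> pt; rewrite patchE mem_set. Qed.

(** Space derivatives at p depend only on the horizontal line through p, and a closed strip contains
    such lines entirely. *)
Lemma eq_dx (u w : R * R -> R) (p : R * R) :
  (forall y, u (y, p.2) = w (y, p.2)) -> dx u p = dx w p.
Proof. by rewrite /dx => uw; rewrite (funext uw). Qed.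

Lemma dx_restrict u t p : 0 <= p.2 <= t -> dx (u \_ (cstrip t)) p = dx u p.
Proof. by move=> pt; apply: eq_dx => y; exact: restrict_cstrip. Qed.

Lemma dxx_restrict u t p : 0 <= p.2 <= t ->
  dx (dx (u \_ (cstrip t))) p = dx (dx u) p.
Proof. by move=> pt; apply: eq_dx => y; exact: dx_restrict. Qed.

(** The quotient over (0, t] is taken along a finer filter than the one over (0, T]; at the new
    final time t the limit becomes one-sided. *)
Lemma dt_quotient_restrict u T t p : t <= T -> strip t p -> derivable_t T u p ->
  dt_quotient t (u \_ (cstrip t)) p --> dt T u p.
Proof.
move=> tT /andP[p0 pt] du.
have sub : within `]0, t] (p.2)^' --> within `]0, T] (p.2)^'.
  move=> A hA; change (\forall r \near (p.2)^', r \in `]0, t] -> A r).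
  have : \forall r \near (p.2)^', r \in `]0, T] -> A r by [].
  apply: filterS => r + rt; apply.
  by move: rt; rewrite !in_itv/= => /andP[-> /le_trans]; exact.
have := cvg_app (fun s => (s - p.2)^-1 * (u (p.1, s) - u p)) sub.
move=> /cvg_trans/(_ du); apply: cvg_trans; apply: near_eq_cvg.
rewrite /= near_withinE; apply: nearW => r /=; rewrite in_itv/= => /andP[r0 rt].
by rewrite !restrict_cstrip//= ?(ltW p0) ?(ltW r0).
Qed.

Lemma dt_restrict u T t p : t <= T -> strip t p -> derivable_t T u p ->
  dt t (u \_ (cstrip t)) p = dt T u p.
Proof.
move=> tT pt du; have := dt_quotient_restrict tT pt du.
by have := within_dnbhs_proper pt => PF; exact: cvg_lim.
Qed.

Lemma Iset_restrict T (f u0 : R -> R) u t : t <= T -> 0 < t ->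
  Iset T f u0 u -> Iset t f u0 (u \_ (cstrip t)).
Proof.
move=> tT t0 [[cf Bu0 _] [cu [du cdt cdx cdxx] bu ueq u_0]].
have cst p : cstrip t p -> cstrip T p.
  by move=> /andP[p0 pt]; rewrite /cstrip/= p0 (le_trans pt).
have sst p : strip t p -> strip T p.
  by move=> /andP[p0 pt]; rewrite /strip/= p0 (le_trans pt).
have sc p : strip t p -> 0 <= p.2 <= t by move=> /andP[/ltW -> ->].
have cu' : {within cstrip t, continuous (u \_ (cstrip t))}.
  apply: (@subspace_eq_continuous _ _ _ u).
    by move=> p /set_mem pt; exact: (esym (restrict_cstrip u pt)).
  exact: continuous_subspaceW cu.
have bu' : [bounded (u \_ (cstrip t)) p | p in cstrip t].
  have [M [Mr bM]] := bu; exists M; split=> // N MN p pt.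
  change (`|(u \_ (cstrip t)) p| <= N).
  by rewrite restrict_cstrip//; apply: (bM N MN); exact: cst.
split; first by split.
split; [exact: cu'| |exact: bu'| |].
- split.
  + move=> p pt; have [h1 h2 h3] := du p (sst p pt); split.
    * by apply/cvg_ex; exists (dt T u p); exact: dt_quotient_restrict.
    * have eq_u : (fun y => (u \_ (cstrip t)) (y, p.2)) = fun y => u (y, p.2).
        by apply/funext => y; rewrite restrict_cstrip// sc.
      by rewrite /derivable_x eq_u; exact: h2.
    * have eq_dx : (fun y => dx (u \_ (cstrip t)) (y, p.2)) =
          fun y => dx u (y, p.2).
        by apply/funext => y; rewrite dx_restrict// sc.
      by rewrite /derivable_x eq_dx; exact: h3.
  + apply: (@subspace_eq_continuous _ _ _ (dt T u)).
      move=> p /set_mem pt; have [h1 _ _] := du p (sst p pt).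
      exact: (esym (dt_restrict tT pt h1)).
    exact: continuous_subspaceW cdt.
  + apply: (@subspace_eq_continuous _ _ _ (dx u)).
      by move=> p /set_mem/sc pt; exact: (esym (dx_restrict u pt)).
    exact: continuous_subspaceW cdx.
  + apply: (@subspace_eq_continuous _ _ _ (dx (dx u))).
      by move=> p /set_mem/sc pt; exact: (esym (dxx_restrict u pt)).
    exact: continuous_subspaceW cdxx.
- move=> p pt; have [h1 _ _] := du p (sst p pt).
  rewrite (dt_restrict tT pt)// dxx_restrict ?sc// restrict_cstrip ?sc//.
  by apply: ueq; exact: sst.
- by move=> x; rewrite restrict_cstrip//= lexx ltW.
Qed.

End restriction.

(** * The bound on centered differences and on the gradient *)

Section gradient.
Context {R : realType}.
Local Notation mu := (@lebesgue_measure R).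

Lemma normB_ge (v : R -> R) x : (`|v x|%:E <= normB v)%E.
Proof. by apply: ereal_sup_ubound; exists x. Qed.

Lemma normB_ge0 (v : R -> R) : (0 <= normB v)%E.
Proof. by apply: le_trans (normB_ge v 0); rewrite lee_fin. Qed.

(** The comparison estimate is applied to the odd part with the single parameter l: the slab
    tolerance is 1 / l, and both error terms vanish as l grows. *)
Lemma centered_difference_le (f u0 : R -> R) (u : R * R -> R)
    (t L I e x s : R) :
  0 < t -> Iset t f u0 u -> 0 <= L -> (normB_deriv u0 <= L%:E)%E ->
  (\int[mu]_(r in `[0%R, t[)
     (normB (fun y => f (u (y, r))) * ((Num.sqrt (t - r))^-1)%:E) <= I%:E)%E ->
  `|e| = 1 -> 0 < s ->
  e * (u (x + s, t) - u (x - s, t)) <= 2 * s * (L + (Num.sqrt pi)^-1 * I).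
Proof.
move=> t0 [[cf Bu0 _] [cu Cu bu ueq u_0]] L0 uL fI e1 s0.
have [M M0 uM] : exists2 M, 0 < M & forall p, cstrip t p -> `|u p| <= M.
  have [M [_ uM]] := bu; exists (`|M| + 1); first by rewrite ltr_wpDl.
  by move=> p pt; apply: uM => //; rewrite ltr_pwDr// ler_norm.
have eM (a b : R) : e * (a - b) <= `|a| + `|b|.
  apply: le_trans (ler_norm _) _; rewrite normrM e1 mul1r.
  exact: ler_normB.
apply/ler_addgt0Pr => eta eta0.
(* A / l is the cost of adding 1 / l to every slab bound; B / l^2 is the quadratic term of the
   barrier at (s, t). *)
pose A := 4 * (Num.sqrt pi)^-1 * s * Num.sqrt t.
pose B := 2 * M * (s ^+ 2 + 3 * t).
have A0 : 0 <= A by rewrite !mulr_ge0 ?invr_ge0 ?sqrtr_ge0// ltW.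
have B0 : 0 <= B by rewrite !mulr_ge0 ?addr_ge0 ?sqr_ge0 ?mulr_ge0 ?ltW.
(* Large enough for s <= l, for 1 / l^2 <= 1 / l, and for (A + B) / l <= eta. *)
pose l := s + 1 + (A + B) / eta.
have AB0 : 0 <= (A + B) / eta by rewrite divr_ge0 ?addr_ge0// ltW.
have l1 : 1 <= l by rewrite /l; lra.
have l0 : 0 < l by lra.
have sl : 0 <= s <= l by rewrite /l; lra.
have il0 : 0 < l^-1 by rewrite invr_gt0.
have ABl : A * l^-1 + B / l ^+ 2 <= eta.
  apply: (@le_trans _ _ ((A + B) / l)).
    rewrite mulrDl lerD2l ler_wpM2l// lef_pV2 ?posrE ?exprn_gt0//.
    by rewrite expr2 ler_peMr// ltW.
  rewrite ler_pdivrMr// -ler_pdivrMl// mulrC /l; lra.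
pose K : set R := `[x - l, x + l]%classic.
have cg : {within K `*` `[0, t], continuous (f \o u)}.
  have cu' : {within K `*` `[0, t], continuous u}.
    apply: continuous_subspaceW cu => -[y r] [_] /=.
    by rewrite in_itv.
  apply/subspace_continuousP => p Kp.
  move/subspace_continuousP : cu' => /(_ p Kp) up.
  exact: (cvg_comp u f up (cf (u p))).
have K0 : K !=set0 by exists x; rewrite /K/= in_itv/=; apply/andP; split; lra.
have [n [d [m [dhomo d0 dn m0 mP]]]] := @cell_partition R K t l^-1 (f \o u)
  (fun r => normB (fun y => f (u (y, r)))) t0 il0 K0 (@segment_compact _ _ _) cg
  (fun r _ => normB_ge0 _) (fun y r _ => normB_ge (fun y => f (u (y, r))) y).
(* The factor 2 accounts for the two values f(u(x + s, r)) and f(u(x - s, r)). *)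
pose c k := 2 * (m k + l^-1).
pose v (p : R * R) := e * (u (x + p.1, p.2) - u (x - p.1, p.2)).
have dn0 k : 0 <= d k by rewrite -d0 dhomo.
have L20 : 0 <= 2 * L by rewrite mulr_ge0.
have M20 : 0 < 2 * M by rewrite mulr_gt0.
have c0 k : 0 <= c k by rewrite mulr_ge0// addr_ge0// ltW.
have cv : {within `[0, l] `*` `[0, t], continuous v}.
  have cs : forall h : R * R -> R, continuous h ->
      {within `[0, l] `*` `[0, t], continuous (fun p => u (h p, p.2))}.
    move=> h ch.
    apply: (@within_continuous_comp_pair _ _ (cstrip t) h snd u) => //.
    - by move=> p; exact: cvg_snd.
    - by move=> p [_] /=; rewrite in_itv.
  move=> p; apply: cvgM; first exact: cvg_cst.
  apply: cvgB; [apply: (cs (fun p => x + p.1))|apply: (cs (fun p => x - p.1))].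
    by move=> q; apply: cvgD; [exact: cvg_cst|exact: cvg_fst].
  by move=> q; apply: cvgB; [exact: cvg_cst|exact: cvg_fst].
have v0 y : 0 <= y <= l -> v (y, 0) <= 2 * L * y.
  move=> /andP[y0 _]; rewrite /v/= !u_0.
  apply: le_trans (ler_norm _) _; rewrite normrM e1 mul1r.
  apply: le_trans (BPC1_lipschitz Bu0 uL _) _; lra.
have vb r : 0 <= r <= t -> v (0, r) <= 0 /\ v (l, r) <= 2 * M.
  move=> rt; rewrite /v/= addr0 subr0 subrr mulr0; split => //.
  apply: le_trans (eM _ _) _.
  have := uM (x + l, r) rt; have := uM (x - l, r) rt; lra.
have vh y r k : 0 < y < l -> (k < n)%N -> d k < r <= d k.+1 ->
    exists2 b, b <= c k & heat_at l v y r b.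
  move=> /andP[y0 yl] kn /andP[dr rd].
  exists (e * (f (u (x + y, r)) - f (u (x - y, r)))).
    apply: le_trans (eM _ _) _.
    have [|_ mk] := mP k r kn; first by rewrite (ltW dr).
    have := mk (x + y); have := mk (x - y); rewrite /K /= !in_itv/= /c.
    have -> : x - l <= x - y <= x + l by apply/andP; split; lra.
    have -> : x - l <= x + y <= x + l by apply/andP; split; lra.
    by move=> /(_ isT) h1 /(_ isT) h2; lra.
  apply: (@heat_at_odd_part R t f u x e l y r Cu ueq).
  by rewrite (le_lt_trans (dn0 k) dr) (le_trans rd)// -dn dhomo.
have stepI : \sum_(k < n) m k *
    (2 * (Num.sqrt (t - d k) - Num.sqrt (t - d k.+1))) <= I.
  rewrite -lee_fin; apply: le_trans fI.
  apply: (@step_integral_ge R n d m t (fun r => normB (fun y => f (u (y, r)))))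
    => // k r kn /andP[dr rd].
  by have [] := mP k r kn; first by rewrite dr ltW.
(* The tolerance 1 / l is the same on every slab, so its total weight telescopes to sqrt t. *)
have telescope : \sum_(k < n)
    (Num.sqrt (t - d k) - Num.sqrt (t - d k.+1)) = Num.sqrt t.
  have := telescope_sumr (fun k => - Num.sqrt (t - d k)) (leq0n n).
  rewrite big_mkord dn d0 subr0 subrr sqrtr0 oppr0 sub0r opprK => <-.
  by apply: eq_bigr => k _; rewrite opprK addrC.
have sumE : \sum_(k < n) c k * (Num.sqrt (t - d k) - Num.sqrt (t - d k.+1)) =
    \sum_(k < n) m k * (2 * (Num.sqrt (t - d k) - Num.sqrt (t - d k.+1))) +
    2 * l^-1 * Num.sqrt t.
  rewrite -telescope mulr_sumr -big_split/=; apply: eq_bigr => k _.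
  by rewrite /c; ring.
have := heat_comparison l0 t0 L20 M20 dhomo d0 dn c0 cv v0 vb vh sl.
rewrite sumE => /le_trans; apply.
set S := \sum_(k < n) _ in stepI *.
have : 2 / Num.sqrt pi * s * S <= 2 / Num.sqrt pi * s * I.
  by rewrite ler_wpM2l// mulr_ge0// ltW.
have -> : 2 / Num.sqrt pi * s * (S + 2 * l^-1 * Num.sqrt t) =
    2 / Num.sqrt pi * s * S + A * l^-1 by rewrite /A; ring.
have -> : 2 * M / l ^+ 2 * (s ^+ 2 + 3 * t) = B / l ^+ 2 by rewrite /B; ring.
have -> : 2 * s * (L + (Num.sqrt pi)^-1 * I) =
    2 * L * s + 2 / Num.sqrt pi * s * I by ring.
by move: ABl; set X := A * l^-1; set Y := B / _; lra.
Qed.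

(** With e the sign of u_x, the centered difference divided by s tends to 2 |u_x| as s decreases to
    0. *)
Lemma dx_le (f u0 : R -> R) (u : R * R -> R) (t L I x : R) :
  0 < t -> Iset t f u0 u -> 0 <= L -> (normB_deriv u0 <= L%:E)%E ->
  (\int[mu]_(r in `[0%R, t[)
     (normB (fun y => f (u (y, r))) * ((Num.sqrt (t - r))^-1)%:E) <= I%:E)%E ->
  `|dx u (x, t)| <= L + (Num.sqrt pi)^-1 * I.
Proof.
move=> t0 uI L0 uL fI; have [_ [_ [du _ _ _] _ _ _]] := uI.
have tt : strip t (x, t) by rewrite /strip/= t0 lexx.
pose e : R := (-1) ^+ (dx u (x, t) < 0)%R.
have e1 : `|e| = 1 by rewrite normr_sign.
have : is_derive x 1 (fun y => u (y, t)) (dx u (x, t)).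
  by have [_ h _] := du _ tt; rewrite /dx derive1E; exact: derivableP.
(* g is the continuous slope function of u(., t) at x, with g x = u_x; hence u(x + s, t) - u(x - s,
   t) = s (g(x + s) + g(x - s)). *)
rewrite normrEsign -/e => /is_derive1_caratheodory[g [gE cg <-]].
set Phi := L + _.
have cshift (b : R) : g (x + b * s) @[s --> 0^'+] --> g x.
  have xs : x + b * s @[s --> 0^'+] --> x + b * 0.
    apply: (@cvg_at_right_filter _ _ (fun s => x + b * s)).
    apply: cvgD; first exact: cvg_cst.
    by apply: cvgM; [exact: cvg_cst|exact: cvg_id].
  rewrite mulr0 addr0 in xs.
  exact: (cvg_comp (fun s => x + b * s) g xs cg).
have lim2 : e * (g (x + 1 * s) + g (x + (-1) * s)) @[s --> 0^'+] -->
    e * (g x + g x).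
  by apply: cvgM; [exact: cvg_cst|apply: cvgD; exact: cshift].
have : e * (g x + g x) <= 2 * Phi.
  apply: (cvgr_to_le lim2); near=> s.
  have s0 : 0 < s by near: s; exact: nbhs_right_gt.
  rewrite -(ler_pM2r s0) [leRHS]mulrAC.
  apply: le_trans (centered_difference_le x t0 uI L0 uL fI e1 s0).
  have h1 := gE (x + s); have h2 := gE (x - s).
  rewrite mul1r mulN1r.
  have -> : u (x + s, t) - u (x - s, t) =
    (u (x + s, t) - u (x, t)) - (u (x - s, t) - u (x, t)) by ring.
  rewrite h1 h2 le_eqVlt; apply/orP; left; apply/eqP; ring.
by lra.
Unshelve. all: by end_near. Qed.

End gradient.

Theorem proposition1p3 (R : realType) (T : R) (f u0 : R -> R)
    (u : R * R -> R) (T_gt0 : 0 < T) (Iu : Iset T f u0 u) (t : R)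
    (t_gt0 : 0 < t) (t_leT : t <= T) :
  Iset t f u0 (u \_ (cstrip t)) /\
  (normB (fun x => dx u (x, t)) <= Ffun t f u0 (u \_ (cstrip t)))%E.
Proof.
have It := Iset_restrict t_leT t_gt0 Iu; split; first exact: It.
set w := u \_ _ in It *.
have uw x : dx u (x, t) = dx w (x, t).
  by rewrite /w dx_restrict//= lexx ltW.
have [[_ Bu0 _] _] := It.
have spi : 0 < (Num.sqrt pi)^-1 :> R by rewrite invr_gt0 sqrt_pi_gt0.
rewrite /Ffun; set I := integral _ _ _.
have I0 : (0 <= I)%E.
  apply: integral_ge0 => r _; apply: mule_ge0; first exact: normB_ge0.
  by rewrite lee_fin invr_ge0 sqrtr_ge0.
(* The Lipschitz bound on [0, 1] forces L >= 0; with L = -1 this also excludes the value -oo of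
   [normB_deriv u0]. *)
have L_ge0 (L : R) : (normB_deriv u0 <= L%:E)%E -> 0 <= L.
  move=> uL; have := BPC1_lipschitz Bu0 uL (@ler01 R).
  by rewrite subr0 mulr1; exact: le_trans.
(* If either term of the functional is +oo the bound is trivial, so the real estimate is applied to
   finite values. *)
case uL : (normB_deriv u0) => [L| |].
- case IE : I I0 => [r| |] I0 //; last first.
    by rewrite gt0_muley ?lte_fin// addey// leey.
  rewrite -EFinM -EFinD; apply: ge_ereal_sup => _ [x _ <-].
  rewrite lee_fin uw; apply: (dx_le x t_gt0 It); rewrite ?L_ge0 ?uL//.
  by rewrite -/I IE.
- rewrite addye ?leey//.
  by rewrite gt_eqF// (lt_le_trans (ltNyr 0))// mule_ge0// lee_fin ltW.
- have := L_ge0 (-1); rewrite uL leNye => /(_ isT).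
  by rewrite ler0N1.
Qed.
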